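(* Let $\mathcal{H}=(X,\varphi,G,r)$ be a (non-blocking) hybrid dynamical system satisfying the Trapping Guard Condition, with hybrid suspension semiflow $\Phi_{\mathcal{H}}$ on $\Sigma_{\mathcal{H}}X$. Let $S\subset X$ be an invariant set under $\mathcal{H}$. Then $S$ is an isolated invariant set under $\mathcal{H}$ if and only if $\Sigma_{\mathcal{H}}(S)$ is an isolated invariant set under $\Phi_{\mathcal{H}}$.
   Context: Notation: $\mathbb{R}^+=[0,\infty)$, $\mathbb{Z}^+=\{0,1,2,\dots\}$, $X$ is a compact metric space. Local semiflow. A local semiflow on $X$ is a continuous map $\varphi:\mathcal{U}\to X$, where $\mathcal{U}\subseteq\mathbb{R}^+\times X$ is an open neighborhood of $\{0\}\times X$, with $\varphi(0,x)=x$, and such that $(t,x)\in\mathcal{U}$ and $(s,\varphi(t,x))\in\mathcal{U}$ imply $(s+t,x)\in\mathcal{U}$ and $\varphi(s+t,x)=\varphi(s,\varphi(t,x))$. It is a semiflow if $\mathcal{U}=\mathbb{R}^+\times X$. Hybrid system. A hybrid dynamical system (HDS) is $\mathcal{H}=(X,\varphi,G,r)$ with $\varphi$ a local semiflow on $X$, $G\subseteq X$ closed (guard), $r:G\to X$ continuous (reset). Impact time: $\sigma(x)=\inf\{t\ge 0: (t,x)\in\mathcal{U},\ \varphi(t,x)\in G\}\in[0,\infty]$ ($\inf\emptyset=\infty$). Hybrid trajectory of $x$: continuous maps $(\gamma_n:I_n\to X)_{n=0}^J$, $J\in\mathbb{Z}^+\cup\{\infty\}$, with $t_0=0$, $\gamma_0(0)=x$,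 $t_{n+1}=t_n+\sigma(\gamma_n(t_n))$, $I_n=[t_n,t_{n+1}]$ (for $n<J$), $I_J=[t_J,t_{J+1})$ if $J<\infty$, $\gamma_{n+1}(t_{n+1})=r(\gamma_n(t_{n+1}))$, and $\gamma_n(t)=\varphi(t-t_n,\gamma_n(t_n))$ for $t\in[t_n,t_{n+1})$ if $t_n<t_{n+1}$. Write $\psi_x(t,n)=\gamma_n(t)$ on $\mathrm{dom}(\psi_x)=\bigcup_n I_n\times\{n\}$, and $\psi([0,\infty),x)=\psi_x(\mathrm{dom}(\psi_x))$. Non-blocking (assumed): every hybrid trajectory is either defined for all $t\ge0$ (with finitely or infinitely many jumps) or is Zeno ($J=\infty$, $t_n\to T<\infty$). Backward hybrid trajectory through $x$: continuous maps $(\gamma_n:I_n\to X)_{n=0}^{-J}$, $J\in\mathbb{Z}^+\cup\{\infty\}$, with $t_0=0\ge t_{-1}\ge t_{-2}\ge\cdots$, $\gamma_0(0)=x$, $I_n=[t_{n-1},t_n]$ for $-J<n\le0$ and, if $J<\infty$, $I_{-J}=(-\infty,t_{-J}]$; $\gamma_n(t)\notin G$ for $t$ in the interior of $I_n$; $\gamma_n(t_n)\in G$ and $r(\gamma_n(t_n))=\gamma_{n+1}(t_n)$ for $n<0$; $\gamma_n(t')=\varphi(t'-t,\gamma_n(t))$ for $t\le t'$ in $I_n$. Its image is denoted $\beta((-\infty,0],x)$. Trapping Guard Condition (TGC): there is an open neighborhood $U\subseteq X$ of $G$ such that $\sigma|_U$ is (finite and) continuous and $H(x,s)=\varphi(s\,\sigma(x),x)$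 defines a strong deformation retraction $H:U\times[0,1]\to U$ of $U$ onto $G$ (continuous, $H(x,0)=x$, $H(x,1)\in G$, $H(g,s)=g$ for $g\in G$). Suspension. $X'=(X\sqcup(G\times[0,1]))/(x\sim(x,0),\,x\in G)$, $\iota:X\hookrightarrow X'$ the inclusion, $\sigma'(\iota(x))=\sigma(x)+1$, $\sigma'(x,s)=1-s$ on $G\times(0,1]$. For $0\le t\le\sigma'(z)$ ($t<\infty$): $\varphi'(t,\iota(x))=\iota(\varphi(t,x))$ if $x\notin G$, $t<\sigma(x)$; $\varphi'(t,\iota(x))=(\varphi(\sigma(x),x),t-\sigma(x))$ if $x\notin G$, $t\ge\sigma(x)$; $\varphi'(t,(x,s))=(x,s+t)$ on $G\times[0,1]$. $\Sigma_{\mathcal{H}}X$ is the quotient of $X'$ by $(g,1)\sim\iota(r(g))$, $g\in G$, with quotient map $\pi:X'\to\Sigma_{\mathcal{H}}X$. The hybrid suspension semiflow $\Phi_{\mathcal{H}}:\mathbb{R}^+\times\Sigma_{\mathcal{H}}X\to\Sigma_{\mathcal{H}}X$ is induced by $\Phi_{\mathcal{H}}(t,[z])=[\varphi'(t,z)]$ for $t\le\sigma'(z)$, continued through the identification by the semigroup property. Known: under TGC, $\Sigma_{\mathcal{H}}X$ is a compact metrizable space and $\Phi_{\mathcal{H}}$ is a (continuous) semiflow. $\pi_0:X'\to X$ collapses the cylinder ($\iota(x)\mapsto x$, $(g,s)\mapsto g$); for $A\subseteq X$, $\Sigma_{\mathcal{H}}(A)=\pi(\pi_0^{-1}(A))$.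 Invariance. For a semiflow $\Phi$ on $Y$: $\mathrm{Inv}^+(B)=\{y:\Phi([0,\infty),y)\subseteq B\}$; $\mathrm{Inv}^-(B)$ is the set of $y$ with a map $\gamma:(-\infty,0]\to B$, $\gamma(0)=y$, $\Phi(s,\gamma(t))=\gamma(t+s)$ for $s\ge0$, $t+s\le0$. For $\mathcal{H}$: $\mathrm{Inv}^+(B,\mathcal{H})=\{x:\psi([0,\infty),x)\subseteq B\}$; $\mathrm{Inv}^-(B,\mathcal{H})$ is the set of $x$ having a backward hybrid trajectory with image in $B$. In both settings $B$ is invariant if $B=\mathrm{Inv}^+(B)=\mathrm{Inv}^-(B)$, $\mathrm{Inv}(K)=\mathrm{Inv}^+(K)\cap\mathrm{Inv}^-(K)$, a compact $K$ is an isolating neighborhood if $\mathrm{Inv}(K)\subseteq\mathrm{int}(K)$, and then $\mathrm{Inv}(K)$ is called an isolated invariant set. *)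

(* Defs.v *)
From HB Require Import structures.
From Stdlib Require Relation_Operators.
From mathcomp Require Import all_boot all_order all_algebra generic_quotient.
From mathcomp Require Import all_classical all_reals all_analysis.

Set Implicit Arguments.
Unset Strict Implicit.
Unset Printing Implicit Defensive.

Import Order.TTheory GRing.Theory Num.Theory.
Import numFieldTopology.Exports numFieldNormedType.Exports.

Local Open Scope classical_set_scope.
Local Open Scope ring_scope.

(** ** Hybrid systems *)

(* Partial maps are total functions together with their domain of definition;
   every use below is guarded by the domain, so values outside it are never
   relevant. [phi] takes time first: [phi t x]. *)
Definition local_semiflow (R : realType) (X : topologicalType)
    (D : set (R * X)) (phi : R -> X -> X) : Prop :=
  [/\ exists2 V : set (R * X), open V & D = V `&` [set p | 0 <= p.1],
      forall x, D (0, x),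
      {within D, continuous (fun p : R * X => phi p.1 p.2)},
      forall x, phi 0 x = x &
      forall s t x, D (t, x) -> D (s, phi t x) ->
        D (s + t, x) /\ phi (s + t) x = phi s (phi t x)].

Record hybrid_system (R : realType) (X : metricType R) := HybridSystem {
  flow_dom : set (R * X);
  flow : R -> X -> X;
  guard : set X;
  reset : X -> X;
  flowP : local_semiflow flow_dom flow;
  guard_closed : closed guard;
  reset_continuous : {within guard, continuous reset} }.

(** ** Invariance, for arbitrary forward and backward operators [ip], [im] *)

Section invariance.
Context {T : topologicalType} (ip im : set T -> set T).

Definition invariant_for (B : set T) : Prop := B = ip B /\ B = im B.

Definition Inv_for (K : set T) : set T := ip K `&` im K.

Definition isolating_nbhd_for (K : set T) : Prop :=
  compact K /\ Inv_for K `<=` K°.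

Definition isolated_invariant_for (S : set T) : Prop :=
  exists2 K, isolating_nbhd_for K & S = Inv_for K.

End invariance.

Section semiflow_invariance.
Context {R : realType} {Y : topologicalType} (Phi : R -> Y -> Y).

Definition semiflow_invp (B : set Y) : set Y :=
  [set y | forall t, 0 <= t -> B (Phi t y)].

Definition semiflow_invm (B : set Y) : set Y :=
  [set y | exists c : R -> Y,
    [/\ forall t, t <= 0 -> B (c t),
        c 0 = y &
        forall s t, 0 <= s -> t + s <= 0 -> Phi s (c t) = c (t + s)]].

Definition semiflow_isolated_invariant : set Y -> Prop :=
  isolated_invariant_for semiflow_invp semiflow_invm.

End semiflow_invariance.

Section hybrid.
Context {R : realType} {X : metricType R} (H : hybrid_system X).

Local Notation D := (flow_dom H).
Local Notation phi := (flow H).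
Local Notation G := (guard H).
Local Notation r := (reset H).

Definition impact_time (x : X) : \bar R :=
  ereal_inf [set t%:E | t in [set t : R | D (t, x) /\ G (phi t x)]].

(** ** Trajectories *)

(* The number of jumps [J] is [Some n] for a finite number, [None] for
   infinitely many. *)
Definition le_jumps (n : nat) (J : option nat) : bool :=
  if J is Some m then (n <= m)%N else true.

Definition lt_jumps (n : nat) (J : option nat) : bool :=
  if J is Some m then (n < m)%N else true.

Definition traj_itv (J : option nat) (t : nat -> \bar R) (n : nat) : set R :=
  if lt_jumps n J then [set s | t n <= s%:E <= t n.+1]%E
  else if le_jumps n J then [set s | t n <= s%:E < t n.+1]%E
  else set0.

(* [t n] is extended-real valued because the right end of the last interval may
   be infinite. *)
Definition hybrid_trajectory (x : X) (J : option nat) (t : nat -> \bar R)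
    (gam : nat -> R -> X) : Prop :=
  [/\ t 0%N = 0%E /\ gam 0%N 0 = x,
      forall n, le_jumps n J ->
        t n \is a fin_num /\
        t n.+1 = (t n + impact_time (gam n (fine (t n))))%E,
      forall n, {within traj_itv J t n, continuous (gam n)},
      forall n, lt_jumps n J ->
        G (gam n (fine (t n.+1))) /\
        gam n.+1 (fine (t n.+1)) = r (gam n (fine (t n.+1))) &
      forall n s, le_jumps n J -> (t n <= s%:E < t n.+1)%E ->
        D (s - fine (t n), gam n (fine (t n))) /\
        gam n s = phi (s - fine (t n)) (gam n (fine (t n)))].

Definition defined_for_all_time (J : option nat) (t : nat -> \bar R) : Prop :=
  forall s : R, 0 <= s -> exists n, traj_itv J t n s.

Definition zeno (J : option nat) (t : nat -> \bar R) : Prop :=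
  J = None /\ exists T : R, t @ \oo --> T%:E.

(* Restricting a trajectory to fewer jumps again gives a trajectory; "the"
   trajectory of a point is the one that cannot be extended in this way. *)
Definition full_trajectory (x : X) (J : option nat) (t : nat -> \bar R)
    (gam : nat -> R -> X) : Prop :=
  hybrid_trajectory x J t gam /\ (defined_for_all_time J t \/ zeno J t).

Definition nonblocking : Prop :=
  forall x, exists J t gam, full_trajectory x J t gam.

Definition traj_range (x : X) : set X :=
  [set y | exists J t gam, full_trajectory x J t gam /\
           exists n s, traj_itv J t n s /\ y = gam n s].

(* Indices are negated: [t k], [gam k] stand for $t_{-k}$, $\gamma_{-k}$. *)
Definition back_itv (J : option nat) (t : nat -> R) (k : nat) : set R :=
  if lt_jumps k J then [set s | t k.+1 <= s <= t k]
  else if le_jumps k J then [set s | s <= t k]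
  else set0.

Definition backward_trajectory (x : X) (J : option nat) (t : nat -> R)
    (gam : nat -> R -> X) : Prop :=
  [/\ [/\ t 0%N = 0, forall k, lt_jumps k J -> t k.+1 <= t k & gam 0%N 0 = x],
      forall k, {within back_itv J t k, continuous (gam k)},
      forall k s, (back_itv J t k)° s -> ~ G (gam k s),
      forall k, lt_jumps k J ->
        G (gam k.+1 (t k.+1)) /\ r (gam k.+1 (t k.+1)) = gam k (t k.+1) &
      forall k s s', back_itv J t k s -> back_itv J t k s' -> s <= s' ->
        D (s' - s, gam k s) /\ gam k s' = phi (s' - s) (gam k s)].

Definition hybrid_invp (B : set X) : set X := [set x | traj_range x `<=` B].

Definition hybrid_invm (B : set X) : set X :=
  [set x | exists J t gam, backward_trajectory x J t gam /\
           forall k s, back_itv J t k s -> B (gam k s)].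

Definition hybrid_invariant : set X -> Prop :=
  invariant_for hybrid_invp hybrid_invm.

Definition hybrid_isolated_invariant : set X -> Prop :=
  isolated_invariant_for hybrid_invp hybrid_invm.

(** ** Trapping guard condition *)

Definition trapping_homotopy (x : X) (s : R) : X :=
  phi (s * fine (impact_time x)) x.

Definition trapping_guard : Prop :=
  exists U : set X,
    [/\ open U /\ G `<=` U,
        (forall x, U x -> impact_time x \is a fin_num) /\
          {within U, continuous impact_time},
        {within U `*` `[0, 1],
          continuous (fun p : X * R => trapping_homotopy p.1 p.2)},
        forall x (s : R), U x -> `[0, 1]%classic s ->
          D (s * fine (impact_time x), x) /\ U (trapping_homotopy x s) &
        [/\ forall x, U x -> trapping_homotopy x 0 = x,
            forall x, U x -> G (trapping_homotopy x 1) &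
            forall g (s : R), G g -> `[0, 1]%classic s ->
              trapping_homotopy g s = g]].

End hybrid.

(** ** Gluing: quotient of a space by the equivalence relation generated by [E] *)

Section gluing.
Context {T : topologicalType} (E : T -> T -> Prop).

Let rst := Relation_Operators.clos_refl_sym_trans T E.

Let gluing_rel' (a b : T) : bool := `[< rst a b >].

Local Lemma gluing_rel_refl : reflexive gluing_rel'.
Proof. by move=> a; apply/asboolP; exact: Relation_Operators.rst_refl. Qed.

Local Lemma gluing_rel_sym : symmetric gluing_rel'.
Proof.
by move=> a b; apply/asboolP/asboolP; exact: Relation_Operators.rst_sym.
Qed.

Local Lemma gluing_rel_trans : transitive gluing_rel'.
Proof.
move=> b a c /asboolP ab /asboolP bc; apply/asboolP.
exact: Relation_Operators.rst_trans ab bc.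
Qed.

Definition gluing_rel := EquivRel _ gluing_rel_refl gluing_rel_sym gluing_rel_trans.

Definition gluing := {eq_quot gluing_rel}%qT.

HB.instance Definition _ := Topological.copy gluing (quotient_topology gluing).
HB.instance Definition _ := Quotient.on gluing.

Definition to_gluing (a : T) : gluing := (\pi_gluing a)%qT.

Lemma to_gluingP a b : to_gluing a = to_gluing b <-> rst a b.
Proof.
split=> [/eqquotP/asboolP //|ab].
by apply/eqquotP/asboolP.
Qed.

Lemma to_gluing_lift (Z : Type) (f : T -> Z) :
  (forall a b, E a b -> f a = f b) ->
  forall a, f (repr (to_gluing a)) = f a.
Proof.
move=> fE a; have rstf u v : rst u v -> f u = f v.
  by elim=> [{}u {}v /fE| |{}u {}v _ ->|{}u {}v w _ -> _ ->].
by apply/rstf/to_gluingP; exact: reprK.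
Qed.

End gluing.

(** ** The suspension *)

Section suspension.
Context {R : realType} {X : metricType R} (H : hybrid_system X).

Local Notation phi := (flow H).
Local Notation G := (guard H).
Local Notation sigma := (impact_time H).
Local Notation I01 := (`[0, 1]%classic : set R).

(* The disjoint union of X and G x [0,1], as a sum over bool. *)
Definition susp_piece (b : bool) : topologicalType :=
  if b return topologicalType then X else (G * I01)%type.

Definition susp_sum : topologicalType := {b : bool & susp_piece b}.

Definition sum_base (x : X) : susp_sum := existT susp_piece true x.

Definition sum_cyl (g : G) (s : I01) : susp_sum :=
  existT susp_piece false (g, s).

Inductive glue_bottom : susp_sum -> susp_sum -> Prop :=
  GlueBottom (g : G) (s : I01) :
    \val s = 0 -> glue_bottom (sum_base (\val g)) (sum_cyl g s).

Definition susp' : topologicalType := gluing glue_bottom.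

Definition iota' (x : X) : susp' := to_gluing _ (sum_base x).

Definition cyl' (g : G) (s : I01) : susp' := to_gluing _ (sum_cyl g s).

Definition sum_collapse (a : susp_sum) : X :=
  match a with
  | existT true x => x
  | existT false p => \val p.1
  end.

Definition collapse (z : susp') : X := sum_collapse (repr z).

Definition sum_impact_time (a : susp_sum) : \bar R :=
  match a with
  | existT true x => (sigma x + 1)%E
  | existT false p => (1 - \val p.2)%:E
  end.

Definition impact_time' (z : susp') : \bar R := sum_impact_time (repr z).

Lemma collapse_iota x : collapse (iota' x) = x.
Proof. by rewrite /collapse to_gluing_lift// => _ _ []. Qed.

Lemma collapse_cyl g s : collapse (cyl' g s) = \val g.
Proof. by rewrite /collapse to_gluing_lift// => _ _ []. Qed.

Lemma impact_time_guard x : G x -> sigma x = 0%E.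
Proof.
have [[V _ DE] D0 _ phi0 _] := flowP H => Gx; apply/eqP.
rewrite eq_le; apply/andP; split.
  by apply: ereal_inf_lbound; exists 0 => //=; rewrite phi0; split.
apply: le_ereal_inf_tmp => _ [t [Dt _] <-]; rewrite lee_fin.
by move: Dt; rewrite DE => -[].
Qed.

Local Lemma sum_impact_time_glue a b :
  glue_bottom a b -> sum_impact_time a = sum_impact_time b.
Proof.
case=> g s s0 /=; rewrite impact_time_guard ?s0 ?subr0 ?add0e//.
by case: g => g /= /set_mem.
Qed.

Lemma impact_time_iota x : impact_time' (iota' x) = (sigma x + 1)%E.
Proof.
by rewrite /impact_time' to_gluing_lift//; exact: sum_impact_time_glue.
Qed.

Lemma impact_time_cyl g s : impact_time' (cyl' g s) = (1 - \val s)%:E.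
Proof.
by rewrite /impact_time' to_gluing_lift//; exact: sum_impact_time_glue.
Qed.

(* [flow'_rule t z z'] is the formula part of $\varphi'(t,z) = z'$; [flow' t z z']
   adds the time bound $0 \le t \le \sigma'(z)$. *)
Inductive flow'_rule (t : R) : susp' -> susp' -> Prop :=
| Flow_base (x : X) :
    ~ G x -> (t%:E < sigma x)%E -> flow_dom H (t, x) ->
    flow'_rule t (iota' x) (iota' (phi t x))
| Flow_hit (x : X) (g : G) (s : I01) :
    ~ G x -> (sigma x <= t%:E)%E -> flow_dom H (fine (sigma x), x) ->
    \val g = phi (fine (sigma x)) x -> \val s = t - fine (sigma x) ->
    flow'_rule t (iota' x) (cyl' g s)
| Flow_cyl (g : G) (s s' : I01) :
    \val s' = \val s + t -> flow'_rule t (cyl' g s) (cyl' g s').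

Definition flow' (t : R) (z z' : susp') : Prop :=
  [/\ 0 <= t, (t%:E <= impact_time' z)%E & flow'_rule t z z'].

Inductive glue_top : susp' -> susp' -> Prop :=
  GlueTop (g : G) (s : I01) :
    \val s = 1 -> glue_top (cyl' g s) (iota' (reset H (\val g))).

Definition suspension : topologicalType := gluing glue_top.

Definition susp_proj (z : susp') : suspension := to_gluing _ z.

(* The graph of the suspension semiflow: [flow'] pushed down to the quotient
   and closed under composition (the semigroup property). *)
Inductive susp_flow_graph : R -> suspension -> suspension -> Prop :=
| Susp_flow_step (t : R) (z z' : susp') :
    flow' t z z' -> susp_flow_graph t (susp_proj z) (susp_proj z')
| Susp_flow_comp (s t : R) (y y' y'' : suspension) :
    susp_flow_graph t y y' -> susp_flow_graph s y' y'' ->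
    susp_flow_graph (s + t) y y''.

(* Under the trapping guard condition and for compact [X] the graph has exactly
   one value for each [t >= 0] and [y]; the default [y] is irrelevant. *)
Definition susp_flow (t : R) (y : suspension) : suspension :=
  xget y [set y' | susp_flow_graph t y y'].

Definition susp_set (A : set X) : set suspension :=
  susp_proj @` (collapse @^-1` A).

End suspension.

Arguments suspension {R X} H.
Arguments susp_proj {R X} H z.
Arguments susp_flow {R X} H t y.
Arguments susp_set {R X} H A _.

(* Main.v *)
Require Import Defs.
From mathcomp Require Import all_boot all_order all_algebra generic_quotient.
From mathcomp Require Import all_classical all_reals all_analysis.
From mathcomp Require Import lra.

Set Implicit Arguments.
Unset Strict Implicit.
Unset Printing Implicit Defensive.

Import Order.TTheory GRing.Theory Num.Theory.
Import numFieldTopology.Exports numFieldNormedType.Exports.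

Local Open Scope classical_set_scope.
Local Open Scope ring_scope.

(** Since [X] is compact, the local semiflow is global. The suspension orbit of
    a point of the base runs through its hybrid trajectory and through the
    cylinders over the guard points met on the way, each of which takes unit
    time. Hence an infinite backward trajectory, even a Zeno one, fills up
    (-oo, 0] in suspension time, and invariance passes between a set [A] and
    its suspension.

    If [K] isolates [S], the suspension of [K] need not be a neighbourhood of
    that of [S] near the points of [r(G)]; the isolating neighbourhood is
    instead [K] together with the points [(g, s)] such that [s <= 1/2] and [g]
    is in [K], or [s >= 1/2] and [r g] is in [K]. Conversely, if [K'] isolates
    the suspension of [S], then the trace of [K'] on the base may contain
    trajectories that leave [K'] inside a cylinder, so one keeps, near the
    guard, only the points [x] such that the whole cylinder over
    [phi (sigma x) x] lies in [K']. *)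

(** * Flow and hybrid trajectories *)

Lemma cvg_within_near (T : topologicalType) (F : set_system T) (A : set T)
    (x : T) :
  Filter F -> F --> x -> (\forall y \near F, A y) -> F --> within A (nbhs x).
Proof.
move=> FF Fx FA B nB.
have nB' : F (fun y => A y -> B y) by exact: (Fx _ nB).
by apply: filterS2 FA nB' => y Ay; exact.
Qed.

Lemma lt_jumpsW n J : lt_jumps n J -> le_jumps n J.
Proof. by case: J => //= m; exact: ltnW. Qed.

Lemma le_jumps_last n J : le_jumps n J -> ~~ lt_jumps n J -> J = Some n.
Proof.
case: J => //= m nm; rewrite -leqNgt => mn.
by congr Some; apply/eqP; rewrite eqn_leq nm mn.
Qed.

Section flow.
Context {R : realType} {X : metricType R} (H : hybrid_system X).
Context (Xcompact : compact [set: X]).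

Local Notation D := (flow_dom H).
Local Notation phi := (flow H).
Local Notation G := (guard H).
Local Notation sigma := (impact_time H).
Local Notation r := (reset H).

(* By compactness the flow exists for a time independent of the point, and
   then the extension property of a local semiflow makes it global. *)
Lemma flow_domE : D = [set p | 0 <= p.1].
Proof.
have [[V oV DE] D0 _ _ Dadd] := flowP H.
have [e /= e0 De] : \forall t \near (0 : R), forall x : X, 0 <= t -> D (t, x).
  move/compact_near_coveringP : Xcompact.
  move=> /(_ R (nbhs (0:R)) (fun t x => 0 <= t -> D (t, x)) _) Xc.
  have : \forall s \near (0 : R), [set: X] `<=` (fun x => 0 <= s -> D (s, x)).
    apply: Xc => x _.
    have : nbhs (0 : R, x) V.
      apply: open_nbhs_nbhs; split=> //.
      by have := D0 x; rewrite DE => -[].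
    case=> -[A B] /= [A0 Bx] AB; exists (B, A) => //= -[y t] [/= By At] t0.
    by rewrite DE; split=> //; exact: (AB (t, y)).
  by apply: filterS => t At x; exact: At.
have De2 x (t : R) : 0 <= t -> t <= e / 2 -> D (t, x).
  move=> t0 te; apply: De => //=; rewrite sub0r normrN ger0_norm//.
  by rewrite (le_lt_trans te)// ltr_pdivrMr// ltr_pMr// ltr1n.
have Dn n x (t : R) : 0 <= t -> t <= n%:R * (e / 2) -> D (t, x).
  elim: n x t => [|n IH] x t t0 tn; first by apply: De2 => //; lra.
  have [te|te] := leP t (e / 2); first exact: De2.
  rewrite (_ : t = e / 2 + (t - e / 2)); last lra.
  apply Dadd; last by apply: De2 => //; lra.
  by apply: IH; [lra|move: tn; rewrite -natr1; lra].
apply/seteqP; split=> [p|[t x] /= t0]; first by rewrite DE => -[].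
apply: (Dn (Num.bound (t / (e / 2)))) => //.
rewrite -ler_pdivrMr; last lra.
by apply/ltW/archi_boundP; rewrite divr_ge0//; lra.
Qed.

Lemma flow0 x : phi 0 x = x.
Proof. by case: (flowP H). Qed.

Lemma flowD (s t : R) (x : X) : 0 <= s -> 0 <= t -> phi (s + t) x = phi s (phi t x).
Proof.
by move=> s0 t0; have [_ _ _ _ DD] := flowP H; apply DD; rewrite flow_domE.
Qed.

Lemma flow_cvg (t : R) (x : X) : 0 <= t ->
  phi p.1 p.2 @[p --> within [set p : R * X | 0 <= p.1] (nbhs (t, x))] -->
    phi t x.
Proof.
move=> t0; have [_ _ + _ _] := flowP H; rewrite flow_domE.
by move=> /subspace_continuousP/(_ (t, x) t0).
Qed.

Lemma flow_cvg_time (t : R) (x : X) : 0 <= t ->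
  phi s x @[s --> within [set s : R | 0 <= s] (nbhs t)] --> phi t x.
Proof.
move=> t0 W nW.
have xt : (s, x) @[s --> t] --> (t, x).
  move=> A [[B C] /= [Bt Cx] BC]; apply: filterS Bt => s Bs.
  by apply: BC; split=> //=; exact: nbhs_singleton.
have nP : nbhs (t, x) (fun p : R * X => 0 <= p.1 -> W (phi p.1 p.2)).
  exact: flow_cvg nW.
exact: (xt _ nP).
Qed.

Lemma flow_cvg_shift (a t : R) (x : X) : a <= t ->
  phi (s - a) x @[s --> within [set s : R | a <= s] (nbhs t)] --> phi (t - a) x.
Proof.
move=> at0 W nW.
have nP : nbhs (t - a) (fun s : R => 0 <= s -> W (phi s x)).
  have ta : 0 <= t - a by rewrite subr_ge0.
  exact: (flow_cvg_time ta nW).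
have sa : (s - a) @[s --> t] --> t - a.
  by apply: cvgB; [exact: cvg_id|exact: cvg_cst].
have nQ : nbhs t (fun s : R => 0 <= s - a -> W (phi (s - a) x)) := sa _ nP.
by apply: filterS nQ => s /= + sa0; apply; rewrite subr_ge0.
Qed.

Lemma impact_ge0 x : (0 <= sigma x)%E.
Proof.
apply: le_ereal_inf_tmp => _ [t [Dt _] <-]; rewrite lee_fin.
by move: Dt; rewrite flow_domE.
Qed.

Lemma fine_impact_ge0 x : 0 <= fine (sigma x).
Proof. exact/fine_ge0/impact_ge0. Qed.

Lemma impact_lt_fin x (e : \bar R) : (sigma x < e)%E -> sigma x \is a fin_num.
Proof.
by move=> xe; rewrite ge0_fin_numE ?impact_ge0// (lt_le_trans xe)// leey.
Qed.

Lemma impact_le (t : R) (x : X) : 0 <= t -> G (phi t x) -> (sigma x <= t%:E)%E.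
Proof.
by move=> t0 Gt; apply: ereal_inf_lbound; exists t => //=; rewrite flow_domE.
Qed.

(** A finite infimum is attained: hitting times approach [u] from above, the flow is continuous in
    time and the guard is closed. *)
Lemma impact_guard (u : R) (x : X) : sigma x = u%:E -> 0 <= u /\ G (phi u x).
Proof.
move=> su; have u0 : 0 <= u by rewrite -lee_fin -su impact_ge0.
split=> //; have /closure_id -> : closed G by exact: guard_closed.
move=> W /(flow_cvg_time u0) [e /= e0 We].
have [_ [t [Dt Gt] <-]] := lb_ereal_inf_adherent (e := e) e0
  (S := [set t%:E | t in [set t : R | D (t, x) /\ G (phi t x)]])
  (etrans (congr1 (fun z => z \is a fin_num) su) isT).
rewrite -/(sigma x) su -EFinD lte_fin => tue.
move: Dt; rewrite flow_domE/= => t0.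
have : (sigma x <= t%:E)%E by exact: impact_le.
rewrite su lee_fin => ut.
exists (phi t x); split=> //; apply: We => //=.
by rewrite ltr_distlC; lra.
Qed.

(** A hit from [phi s x] at time [t] is a hit from [x] at time [t + s], which gives one inequality;
    the other uses that a finite impact time is attained. *)
Lemma impact_flow (s : R) (x : X) : 0 <= s -> (s%:E <= sigma x)%E ->
  (sigma (phi s x) = sigma x - s%:E)%E.
Proof.
move=> s0 ss; apply/le_anti/andP; split; last first.
  apply: le_ereal_inf_tmp => _ [t [Dt Gt] <-].
  have t0 : 0 <= t by move: Dt; rewrite flow_domE.
  by rewrite leeBlDr// -EFinD; apply: impact_le; [lra|rewrite flowD].
case E : (sigma x) ss => [u| |]; [|by rewrite addye ?leey|by []].
  rewrite lee_fin => su; have [u0 Gu] := impact_guard E.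
  by apply: impact_le; [lra|rewrite -flowD ?subrK//; lra].
Qed.

(** Meaningful for finite [sigma x]; otherwise [fine] turns the time into 0 and the value is [x]. *)
Definition hit (x : X) : X := phi (fine (sigma x)) x.

Lemma hit_guard x : sigma x \is a fin_num -> G (hit x).
Proof.
rewrite fin_numE /hit; case E : (sigma x) => [u| |]//= _.
exact: (impact_guard E).2.
Qed.

(** The range of a trajectory freed of time stamps and jump counts, so as to allow induction on the
    jumps. The bound on [t] is closed in order to include the impact point. *)
Inductive hybrid_reach (x : X) : X -> Prop :=
| Reach_flow (t : R) : 0 <= t -> (t%:E <= sigma x)%E -> hybrid_reach x (phi t x)
| Reach_jump z : sigma x \is a fin_num -> hybrid_reach (r (hit x)) z ->
    hybrid_reach x z.

Lemma hybrid_reach_refl x : hybrid_reach x x.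
Proof.
by rewrite -{2}(flow0 x); apply: Reach_flow => //; exact: impact_ge0.
Qed.

Lemma hybrid_reach_hit x : sigma x \is a fin_num -> hybrid_reach x (hit x).
Proof.
move=> fs; apply: Reach_flow; last by rewrite fineK.
by apply: fine_ge0; exact: impact_ge0.
Qed.

Definition rebase (x : X) (n : nat) : X := iter n (fun z => r (hit z)) x.

Lemma hybrid_reachP x z : hybrid_reach x z <->
  exists n t, [/\ forall k, (k < n)%N -> sigma (rebase x k) \is a fin_num,
    0 <= t, (t%:E <= sigma (rebase x n))%E & z = phi t (rebase x n)].
Proof.
split=> [|[n [t [fk t0 ts ->]]]].
- elim=> {x z} [x t t0 ts|x z fs _ [n [t [fk t0 ts ->]]]].
    by exists 0%N, t; split.
  have iS k : rebase (r (hit x)) k = rebase x k.+1 by rewrite /rebase iterSr.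
  exists n.+1, t; split=> //; rewrite -?iS// => -[|k] kn //.
  by rewrite -iS; exact: fk.
- elim: n x fk ts => [|n IH] x fk ts; first exact: Reach_flow.
  apply: Reach_jump; first exact: (fk 0%N).
  have iS k : rebase (r (hit x)) k = rebase x k.+1 by rewrite /rebase iterSr.
  rewrite -iS; apply: IH; last by rewrite iS.
  by move=> k kn; rewrite iS; exact: fk.
Qed.

(** * Trajectories and the points they reach *)

Section trajectory.
Context (x : X) (J : option nat) (t : nat -> \bar R) (gam : nat -> R -> X).
Context (traj : hybrid_trajectory H x J t gam).

Lemma traj_pos n s : traj_itv J t n s -> le_jumps n J /\ (t n <= s%:E)%E.
Proof.
rewrite /traj_itv; case: ifPn => [nJ /andP[]|_]; first by rewrite lt_jumpsW.
by case: ifP => // nJ /andP[].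
Qed.

(** At the right end of an arc, which the defining formula leaves out, both sides are limits from
    the left, and limits in a metric space are unique. *)
Lemma traj_flow n s : le_jumps n J -> traj_itv J t n s ->
  gam n s = phi (s - fine (t n)) (gam n (fine (t n))).
Proof.
have [_ Ht Hc _ Hphi] := traj => nJ ns.
have [_ tns] := traj_pos ns.
have [ft tS] := Ht _ nJ.
have [tSs|] := ltP s%:E (t n.+1); first by apply Hphi; rewrite ?tns.
move: ns; rewrite /traj_itv; case: ifP => [nJ'|_]; last first.
  by rewrite nJ => /andP[_]; rewrite ltNge => /negP.
move=> /andP[_ sts] tss.
have tE : t n.+1 = s%:E by apply/le_anti/andP.
(* An arc reduced to a point admits no limit from the left; there the flow time is 0. *)
have [sE|sE] := eqVneq (t n) s%:E.
  by rewrite sE /= subrr flow0.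
have tlt : fine (t n) < s by rewrite -lte_fin fineK// lt_neqAle sE.
have := Hc n; rewrite /traj_itv nJ' tE => /subspace_continuousP/(_ s).
set I := [set _ | _] => /(_ _) gamI.
have near_lt : \forall u \near s^'-, fine (t n) < u < s.
  by near=> u; apply/andP; split; near: u; [exact: nbhs_left_gt|exact: nbhs_left_lt].
have cgam : gam n u @[u --> s^'-] --> gam n s.
  apply: cvg_trans (gamI _); last by rewrite /I /= tns lexx.
  apply: cvg_app; apply: cvg_within_near; first exact: cvg_within.
  apply: filterS near_lt => u /andP[/ltW tu us].
  by rewrite /I /= -(fineK ft) !lee_fin tu ltW.
have cphi : phi (u - fine (t n)) (gam n (fine (t n))) @[u --> s^'-] -->
    phi (s - fine (t n)) (gam n (fine (t n))).
  apply: cvg_trans (flow_cvg_shift (ltW tlt)).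
  apply: cvg_app; apply: cvg_within_near; first exact: cvg_within.
  by apply: filterS near_lt => u /andP[/ltW].
apply: (cvg_unique (@metric_hausdorff _ X) cgam); apply: cvg_trans cphi.
apply: near_eq_cvg; apply: filterS near_lt => u /andP[tu us].
have tu' : (t n <= u%:E < t n.+1)%E.
  by rewrite tE -(fineK ft) lee_fin lte_fin ltW.
by have [_ ->] := Hphi n u nJ tu'.
Unshelve. all: by end_near. Qed.

Lemma traj_start n : le_jumps n J ->
  gam n (fine (t n)) = rebase x n /\
  forall k, (k < n)%N -> sigma (rebase x k) \is a fin_num.
Proof.
have [[t0 gam0] Ht _ Hjump _] := traj.
elim: n => [_|n IH nJ]; first by rewrite t0.
have nJ' : lt_jumps n J by case: J nJ.
have [gamE fk] := IH (lt_jumpsW nJ').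
have [ft tS] := Ht _ (lt_jumpsW nJ').
have [ftS _] := Ht _ nJ.
have [_ ->] := Hjump _ nJ'.
rewrite gamE in tS.
have fs : sigma (rebase x n) \is a fin_num.
  by move: ftS; rewrite tS fin_numD => /andP[].
have sE : fine (t n.+1) - fine (t n) = fine (sigma (rebase x n)).
  by rewrite tS fineD// addrC addKr.
split; last first.
  by move=> k; rewrite ltnS leq_eqVlt => /orP[/eqP->//|]; exact: fk.
rewrite traj_flow; [by rewrite gamE sE|exact: lt_jumpsW|].
by rewrite /traj_itv nJ' /= fineK// lexx tS andbT leeDl ?impact_ge0.
Qed.

End trajectory.

(** A finite impact time on the last arc would end the trajectory at the finite time [t m.+1], and
    finitely many jumps exclude the Zeno case. *)
Lemma full_traj_last_impact x m t gam :
  full_trajectory H x (Some m) t gam -> ~ sigma (rebase x m) \is a fin_num.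
Proof.
move=> [traj [all|[]//]] fs; have [_ Ht _ _ _] := traj.
have [gamE _] := traj_start traj (leqnn m).
have [ft tS] := Ht _ (leqnn m).
have ftS : t m.+1 \is a fin_num by rewrite tS fin_numD ft gamE fs.
have mono k j : (j + k = m.+1)%N -> (t j <= t m.+1)%E.
  elim: k j => [|k IH] j; first by rewrite addn0 => ->.
  rewrite addnS -addSn => jk; apply: le_trans (IH _ jk).
  have jm : (j <= m)%N by rewrite -ltnS -jk leq_addr.
  by have [_ ->] := Ht _ jm; rewrite leeDl ?impact_ge0.
have t0 : 0 <= fine (t m.+1).
  by apply: fine_ge0; have [[<- _] _ _ _ _] := traj; exact: (mono m.+1).
pose u := fine (t m.+1) + 1.
have uE : u%:E = (t m.+1 + 1%:E)%E by rewrite /u EFinD fineK.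
have [|k] := all u; first by rewrite /u; lra.
rewrite /traj_itv.
have ltE : (t m.+1 < u%:E)%E by rewrite uE lteDl// lte_fin.
case: ifP => km; last first.
  case: ifP => // km' /andP[_]; have -> : k = m.
    by apply/eqP; rewrite eqn_leq [(k <= m)%N]km' leqNgt [(k < m)%N]km.
  by move=> /(lt_trans ltE); rewrite ltxx.
have mk : (k.+1 + (m - k) = m.+1)%N by rewrite addSn subnKC// ltnW.
move=> /andP[_ tk]; have := lt_le_trans ltE (le_trans tk (mono _ _ mk)).
by rewrite ltxx.
Qed.

(** The arcs of a trajectory are forced by [traj_start]; conversely, by [full_traj_last_impact], a
    full trajectory cannot stop before the jumps that lead to [z]. *)
Lemma traj_rangeE (Hnonblocking : nonblocking H) x :
  traj_range H x = hybrid_reach x.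
Proof.
apply/seteqP; split=> [_ [J [t [gam [[traj _] [n [s [ns ->]]]]]]]|z].
  have [nJ tns] := traj_pos ns.
  have [gamE fk] := traj_start traj nJ.
  have [_ Ht _ _ _] := traj; have [ft tS] := Ht _ nJ.
  apply/hybrid_reachP; exists n, (s - fine (t n)).
  rewrite (traj_flow traj nJ ns) gamE; split=> //.
    by rewrite subr_ge0 -lee_fin fineK.
  rewrite EFinB leeBlDr// addeC fineK// -gamE -tS.
  move: ns; rewrite /traj_itv; case: ifP => _; first by case/andP.
  by rewrite nJ => /andP[_ /ltW].
move=> /hybrid_reachP[n [s [fk s0 ss ->]]].
have [J [t [gam full]]] := Hnonblocking x.
have [traj _] := full; have [_ Ht _ _ _] := traj.
have nJ : le_jumps n J.
  case: J full {traj Ht} => [m|]//= full; rewrite leqNgt; apply/negP => mn.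
  exact: (full_traj_last_impact full (fk _ mn)).
have [gamE _] := traj_start traj nJ.
have [ft tS] := Ht _ nJ.
have ns : traj_itv J t n (fine (t n) + s).
  rewrite /traj_itv tS gamE.
  case: ifPn => [_|nJ']; rewrite ?nJ /= EFinD fineK//.
    by rewrite leeDl ?lee_fin//= leeD2l.
  rewrite leeDl ?lee_fin// lteD2lE// lt_neqAle ss andbT.
  (* The last interval is open on the right; lying at its right end would make the last impact time
     finite. *)
  apply/eqP => sE; have nE := le_jumps_last nJ nJ'.
  by rewrite nE in full; apply: (full_traj_last_impact full); rewrite -sE.
exists J, t, gam; split=> //; exists n, (fine (t n) + s).
by split=> //; rewrite (traj_flow traj nJ ns) gamE addrC addKr.
Qed.

End flow.

(** * Points and semiflow of the suspension *)

Section suspension_points.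
Context {R : realType} {X : metricType R} (H : hybrid_system X).

Local Notation phi := (flow H).
Local Notation G := (guard H).
Local Notation sigma := (impact_time H).
Local Notation r := (reset H).
Local Notation I01 := (`[0, 1]%classic : set R).

Definition base (x : X) : suspension H := susp_proj H (iota' H x).

(* Junk unless [G g] and [0 <= s <= 1]. *)
Definition cyl (g : X) (s : R) : suspension H :=
  xget (base g) [set y | exists (g' : G) (s' : I01),
    [/\ \val g' = g, \val s' = s & y = susp_proj H (cyl' g' s')]].

Lemma susp_proj_cyl (g : G) (s : I01) :
  susp_proj H (cyl' g s) = cyl (\val g) (\val s).
Proof.
rewrite /cyl; case: xgetP => [_ _ [g' [s' [gE sE ->]]]|/(_ (susp_proj H (cyl' g s)))].
  by rewrite (val_inj gE) (val_inj sE).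
by case; exists g, s.
Qed.

Lemma cylP (g : X) (s : R) : G g -> 0 <= s <= 1 ->
  exists (g' : G) (s' : I01), \val g' = g /\ \val s' = s.
Proof.
move=> Gg s01; exists (SigSub (mem_set Gg)).
have sI : I01 s by rewrite /= in_itv.
by exists (SigSub (mem_set sI)).
Qed.

Lemma cyl0 g : G g -> cyl g 0 = base g.
Proof.
move=> Gg; have [|g' [s' [<- s0]]] := cylP Gg (s := 0); first by rewrite lexx ler01.
rewrite -s0 -susp_proj_cyl; congr susp_proj; apply/esym/to_gluingP.
by apply: Relation_Operators.rst_step; constructor.
Qed.

Lemma cyl1 g : G g -> cyl g 1 = base (r g).
Proof.
move=> Gg; have [|g' [s' [<- s1]]] := cylP Gg (s := 1); first by rewrite lexx ler01.
rewrite -s1 -susp_proj_cyl; apply/to_gluingP.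
by apply: Relation_Operators.rst_step; constructor.
Qed.

(* Representatives of the points of the suspension: [inl x] for [x] in the
   base, [inr (g, s)] inside the open cylinder. *)
Definition susp_sum_nf (a : susp_sum H) : X + X * R :=
  match a with
  | existT true x => inl x
  | existT false p =>
      if \val p.2 == 0 then inl (\val p.1)
      else if \val p.2 == 1 then inl (r (\val p.1))
      else inr (\val p.1, \val p.2)
  end.

Definition susp_nf (y : suspension H) : X + X * R :=
  susp_sum_nf (repr (repr y : susp' H)).

(** The normal form is constant along both gluings, hence well defined on the iterated quotient; it
    serves to tell points of the suspension apart. *)
Lemma susp_nf_proj a : susp_nf (susp_proj H (to_gluing _ a)) = susp_sum_nf a.
Proof.
have bot b c : glue_bottom (H:=H) b c -> susp_sum_nf b = susp_sum_nf c.
  by case=> g s /= ->; rewrite eqxx.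
rewrite /susp_nf /susp_proj.
rewrite (to_gluing_lift (f := fun z : susp' H => susp_sum_nf (repr z))).
  exact: to_gluing_lift.
move=> _ _ [g s s1]; rewrite /cyl' /iota' !to_gluing_lift//=.
by rewrite s1 eqxx oner_eq0.
Qed.

Lemma susp_nf_base x : susp_nf (base x) = inl x.
Proof. exact: susp_nf_proj. Qed.

Lemma susp_nf_cyl g s : G g -> 0 < s < 1 -> susp_nf (cyl g s) = inr (g, s).
Proof.
move=> Gg /andP[s0 s1].
have [|g' [s' [<- sE]]] := cylP Gg (s := s); first by rewrite !ltW.
by rewrite -sE -susp_proj_cyl susp_nf_proj/= sE gt_eqF// lt_eqF.
Qed.

Lemma base_inj : injective base.
Proof. by move=> x x' /(congr1 susp_nf); rewrite !susp_nf_base => -[]. Qed.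

Lemma base_neq_cyl x g s : G g -> 0 < s < 1 -> base x <> cyl g s.
Proof.
by move=> Gg s01 /(congr1 susp_nf); rewrite susp_nf_base susp_nf_cyl.
Qed.

Lemma cyl_inj g s g' s' : G g -> 0 < s < 1 -> G g' -> 0 < s' < 1 ->
  cyl g s = cyl g' s' -> g = g' /\ s = s'.
Proof.
by move=> Gg s01 Gg' s01' /(congr1 susp_nf); rewrite !susp_nf_cyl// => -[].
Qed.

Lemma susp'P (z : susp' H) : (exists x, z = iota' H x) \/
  exists (g : G) (s : I01), z = cyl' g s.
Proof.
rewrite -(reprK z); case: (repr z) => -[x|[g s]]; first by left; exists x.
by right; exists g, s.
Qed.

Lemma cyl'_val (g : G) (s : I01) : G (\val g) /\ 0 <= \val s <= 1.
Proof.
split; first exact/set_mem/(valP g).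
by have /set_mem := valP s; rewrite /= in_itv.
Qed.

Lemma suspP (y : suspension H) : (exists x, y = base x) \/
  exists g s, [/\ G g, 0 < s < 1 & y = cyl g s].
Proof.
rewrite -(reprK y); case: (susp'P (repr y)) => [[x ->]|[g [s ->]]].
  by left; exists x.
have [Gg /andP[s0 s1]] := cyl'_val g s.
have -> : (\pi_(suspension H) (cyl' g s))%qT = cyl (\val g) (\val s).
  exact: susp_proj_cyl.
have [sE|sN0] := eqVneq (\val s) 0.
  by left; exists (\val g); rewrite sE cyl0.
have [sE|sN1] := eqVneq (\val s) 1.
  by left; exists (r (\val g)); rewrite sE cyl1.
by right; exists (\val g), (\val s); rewrite !lt_neqAle s0 s1 sN1 eq_sym sN0.
Qed.

Lemma susp_setE A : susp_set H A =
  base @` A `|` [set y | exists g s, [/\ A g, G g, 0 <= s <= 1 & y = cyl g s]].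
Proof.
apply/seteqP; split=> [_ [z Az <-]|y [[x Ax <-]|[g [s [Ag Gg s01 ->]]]]].
- case: (susp'P z) Az => [[x ->]|[g [s ->]]] /=.
    by rewrite collapse_iota => Ax; left; exists x.
  rewrite collapse_cyl => Ag; right; have [Gg s01] := cyl'_val g s.
  by exists (\val g), (\val s); rewrite susp_proj_cyl.
- by exists (iota' H x); rewrite //= collapse_iota.
- have [g' [s' [gE sE]]] := cylP Gg s01.
  exists (cyl' g' s'); first by rewrite /= collapse_cyl gE.
  by rewrite susp_proj_cyl gE sE.
Qed.

(** * The suspension semiflow is single-valued and defined for all times *)

Context (Xcompact : compact [set: X]).

(* [susp_run t x y]: the suspension orbit of [base x] is at [y] at time [t]. *)
Inductive susp_run : R -> X -> suspension H -> Prop :=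
| Run_flow (t : R) x : 0 <= t -> (t%:E <= sigma x)%E ->
    susp_run t x (base (phi t x))
| Run_cyl (s : R) x : sigma x \is a fin_num -> 0 < s < 1 ->
    susp_run (fine (sigma x) + s) x (cyl (hit H x) s)
| Run_jump (t : R) x y : sigma x \is a fin_num -> susp_run t (r (hit H x)) y ->
    susp_run (fine (sigma x) + 1 + t) x y.

Lemma susp_run_ge0 t x y : susp_run t x y -> 0 <= t.
Proof.
elim=> {t x y} [//|s x _ /andP[s0 _]|t x y _ _ t0].
  by have := fine_impact_ge0 H Xcompact x; lra.
by have := fine_impact_ge0 H Xcompact x; lra.
Qed.

Lemma susp_run_inv t x y : susp_run t x y ->
  [\/ [/\ 0 <= t, (t%:E <= sigma x)%E & y = base (phi t x)],
      [/\ sigma x \is a fin_num, 0 < t - fine (sigma x) < 1 &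
          y = cyl (hit H x) (t - fine (sigma x))] |
      sigma x \is a fin_num /\ susp_run (t - fine (sigma x) - 1) (r (hit H x)) y].
Proof.
case=> {t x y} [t x t0 ts|s x fs s01|t x y fs xy]; first by constructor 1.
  by constructor 2; rewrite addrC addKr.
by constructor 3; split=> //; rewrite (_ : _ - 1 = t)//; lra.
Qed.

(** The three rules occupy disjoint ranges of time: up to [sigma x], strictly between [sigma x] and
    [sigma x + 1], and from [sigma x + 1] on. *)
Lemma susp_run_inj t x y y' : susp_run t x y -> susp_run t x y' -> y = y'.
Proof.
have le_fin t0 x0 : sigma x0 \is a fin_num ->
    (t0%:E <= sigma x0)%E -> t0 <= fine (sigma x0).
  by move=> fs; rewrite -{1}(fineK fs) lee_fin.
move=> xy; elim: xy y' => {t x y} [t x t0 ts|s x fs s01|t x y fs xy IH] y'.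
- case/susp_run_inv => [[_ _ ->]//|[fs s01 _]|[fs /susp_run_ge0 t1]];
    by exfalso; have := le_fin _ _ fs ts; lra.
- case/susp_run_inv => [[_ /(le_fin _ _ fs) ? _]|[_ _ ->]|[_ /susp_run_ge0 ?]].
  + by exfalso; lra.
  + by rewrite (_ : _ - _ = s)//; lra.
  + by exfalso; lra.
- have t0 := susp_run_ge0 xy.
  case/susp_run_inv => [[_ /(le_fin _ _ fs) ? _]|[_ ? _]|[_]].
  + by exfalso; lra.
  + by exfalso; lra.
  + by rewrite (_ : _ - 1 = t); [exact: IH|lra].
Qed.

Lemma susp_run_guard g s : G g -> 0 <= s <= 1 -> susp_run s g (cyl g s).
Proof.
move=> Gg s01; have sg := impact_time_guard Gg.
have fs : sigma g \is a fin_num by rewrite sg.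
have hg : hit H g = g by rewrite /hit sg flow0.
have [->|s0] := eqVneq s 0.
  rewrite cyl0// -[X in base X](flow0 H); apply: Run_flow => //.
  exact: impact_ge0.
have [->|s1] := eqVneq s 1.
  rewrite (_ : 1 = fine (sigma g) + 1 + 0); last by rewrite sg /= add0r addr0.
  apply: Run_jump => //; rewrite hg sg /= add0r addr0 cyl1//.
  rewrite -[X in base X](flow0 H); apply: Run_flow => //.
  exact: impact_ge0.
have s01' : 0 < s < 1 by rewrite !lt_neqAle s1 eq_sym s0.
by have := Run_cyl fs s01'; rewrite hg sg /= add0r.
Qed.

Lemma susp_run_cyl s x : sigma x \is a fin_num -> 0 <= s <= 1 ->
  susp_run (fine (sigma x) + s) x (cyl (hit H x) s).
Proof.
move=> fs /andP[s0 s1]; have Gh := hit_guard Xcompact fs.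
have f0 := fine_impact_ge0 H Xcompact x.
have [->|s0'] := eqVneq s 0.
  rewrite cyl0// addr0; apply: Run_flow => //.
  by rewrite fineK.
have [->|s1'] := eqVneq s 1.
  rewrite cyl1// -[X in susp_run X]addr0; apply: Run_jump => //.
  rewrite -[X in base X](flow0 H); apply: Run_flow => //.
  exact: impact_ge0.
by apply: Run_cyl => //; rewrite !lt_neqAle s1' eq_sym s0' s0.
Qed.

(** A graph step may start from any representative of [y]; this shows that every choice continues
    one and the same run. The inner induction is on the run: a jump reduces to its tail. *)
Lemma susp_graph_run t y y' : susp_flow_graph t y y' ->
  0 <= t /\ forall s x, susp_run s x y -> susp_run (t + s) x y'.
Proof.
elim=> {t y y'} [t z z' [t0 tz zz']|s t y y' y'' _ [t0 IHt] _ [s0 IHs]]; last first.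
  split=> [|u x xy]; first exact: addr_ge0.
  by rewrite -addrA; apply: IHs; exact: IHt.
split=> // s x; move Ey : (susp_proj H z) => y xy.
elim: xy Ey => {s x y} [s x s0 sx|s x fs /andP[s0 s1]|s x y fs xy IH] Ey; last first.
- by rewrite addrC -addrA; apply: Run_jump => //; rewrite addrC; exact: IH.
- have Gh := hit_guard Xcompact fs.
  case: zz' tz Ey => [w _ _ _|w g u _ _ _ _ _|g u u' uu'] tz.
  + by move/base_neq_cyl => []//; apply/andP.
  + by move/base_neq_cyl => []//; apply/andP.
  + have [Gg /andP[u0 u1]] := cyl'_val g u.
    have [_ /andP[u0' u1']] := cyl'_val g u'.
    rewrite !susp_proj_cyl.
    have [uE|uN0] := eqVneq (\val u) 0.
      by rewrite uE cyl0// => /base_neq_cyl[]//; apply/andP.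
    have [uE|uN1] := eqVneq (\val u) 1.
      by rewrite uE cyl1// => /base_neq_cyl[]//; apply/andP.
    case/cyl_inj => //; try by rewrite ?s0 ?s1 ?lt_neqAle ?uN1 ?u0 1?eq_sym ?uN0.
    move=> gE uE; rewrite gE uu' uE addrCA [t + _]addrC.
    by apply: susp_run_cyl => //; rewrite -uE -uu' u0'.
- have step (u : R) : (sigma (phi s x) = u%:E) ->
    sigma x \is a fin_num /\ fine (sigma x) = s + u.
    rewrite impact_flow//; case: (sigma x) => [v| |]//= [<-].
    by split=> //; lra.
  case: zz' tz Ey => [w Gw ts _|w g u Gw st _ gE uE|g u u' uu'] tz.
  + move/base_inj => wE; move: ts; rewrite wE => ts.
    rewrite -flowD//; apply: Run_flow; first exact: addr_ge0.
    by move: ts; rewrite impact_flow// EFinD lteBrDr// => /ltW.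
  + move/base_inj => wE; rewrite wE in st gE uE.
    have fw : sigma (phi s x) \is a fin_num.
      by apply: (impact_lt_fin Xcompact (e := +oo%E)); rewrite (le_lt_trans st) ?ltry.
    have [fx fE] := step _ (esym (fineK fw)).
    have f0 := fine_impact_ge0 H Xcompact (phi s x).
    rewrite susp_proj_cyl gE uE -flowD// addrC.
    rewrite (_ : phi _ x = hit H x); last by rewrite /hit fE addrC.
    rewrite (_ : s + t = fine (sigma x) + (t - fine (sigma (phi s x)))).
      apply: susp_run_cyl => //; rewrite -uE.
      by have [] := cyl'_val g u.
    by rewrite fE; lra.
  + have [Gg /andP[u0 u1]] := cyl'_val g u.
    have [_ /andP[u0' u1']] := cyl'_val g u'.
    rewrite !susp_proj_cyl.
    (* The bottom of a cylinder is a guard point of the base, so the run is exactly at its impact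
       time. *)
    have [uE|uN0] := eqVneq (\val u) 0.
      rewrite uE cyl0// => /base_inj gE; rewrite uE add0r in uu'.
      have := impact_time_guard Gg; rewrite gE => /step[fx]; rewrite addr0 => sE.
      rewrite (_ : phi s x = hit H x); last by rewrite /hit sE.
      rewrite uu' -{1}sE addrC; apply: susp_run_cyl => //.
      by rewrite -uu' u0'.
    (* At the top of a cylinder the height cannot grow, which forces [t = 0]. *)
    have [uE|uN1] := eqVneq (\val u) 1.
      have t00 : t = 0 by lra.
      rewrite uu' uE t00 addr0 cyl1// => ->; rewrite add0r.
      exact: Run_flow.
    move/esym/base_neq_cyl => []//.
    by rewrite !lt_neqAle u0 u1 uN1 eq_sym uN0.
Qed.

Lemma susp_has_run y : exists s x, susp_run s x y.
Proof.
case: (suspP y) => [[x ->]|[g [s [Gg s01 ->]]]].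
  exists 0, x; rewrite -[X in base X](flow0 H); apply: Run_flow => //.
  exact: impact_ge0.
exists s, g; apply: susp_run_guard => //.
by case/andP: s01 => s0 s1; rewrite !ltW.
Qed.

(** Every point lies on a run, and any two graph values continue that run to the same time. *)
Lemma susp_flowE t y y' : susp_flow_graph t y y' -> susp_flow H t y = y'.
Proof.
move=> tyy'; rewrite /susp_flow; case: xgetP => [z _|/(_ y')] //= tyz.
have [s [x xy]] := susp_has_run y.
by apply: (susp_run_inj ((susp_graph_run tyz).2 _ _ xy));
  exact: ((susp_graph_run tyy').2 _ _ xy).
Qed.

Lemma graph_cyl t g s : G g -> 0 <= s -> 0 <= t -> s + t <= 1 ->
  susp_flow_graph t (cyl g s) (cyl g (s + t)).
Proof.
move=> Gg s0 t0 st1.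
have [|g' [s' [gE sE]]] := cylP Gg (s := s); first by rewrite s0/=; lra.
have [|g2 [s2 [gE2 sE2]]] := cylP Gg (s := s + t); first by rewrite st1 addr_ge0.
have gg : g' = g2 by apply: val_inj; rewrite gE.
rewrite -sE2 -{2}gE2 -{1}gE -{1}sE -!susp_proj_cyl -gg.
apply: Susp_flow_step; split=> //.
  by rewrite impact_time_cyl lee_fin sE; lra.
by apply: Flow_cyl; rewrite sE.
Qed.

(** The flow rules exclude guard points as starting points: there [t = 0] and the cylinder rule is
    applied at the bottom. Arrival on the guard is [Flow_hit] with height 0. *)
Lemma graph_flow (t : R) x : 0 <= t -> (t%:E <= sigma x)%E ->
  susp_flow_graph t (base x) (base (phi t x)).
Proof.
move=> t0 ts; have [Gx|Gx] := pselect (G x).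
  have : t = 0.
    by move: ts; rewrite impact_time_guard// lee_fin; lra.
  move=> ->; rewrite flow0 -cyl0//.
  have : susp_flow_graph 0 (cyl x 0) (cyl x (0 + 0)).
    by apply: graph_cyl; rewrite ?addr0.
  by rewrite addr0.
have [tl|tl] := ltP t%:E (sigma x).
  apply: Susp_flow_step; split=> //.
    by rewrite impact_time_iota (le_trans ts)// leeDl.
  by apply: Flow_base => //; rewrite flow_domE.
have sE : sigma x = t%:E by apply/le_anti/andP.
have [_ Gh] := impact_guard Xcompact sE.
rewrite -[base (phi t x)]cyl0//.
have [|g [s [gE sE']]] := cylP Gh (s := 0); first by rewrite lexx ler01.
rewrite -gE -sE' -susp_proj_cyl; apply: Susp_flow_step; split=> //.
  by rewrite impact_time_iota sE lee_fin lerDl.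
by apply: Flow_hit; rewrite ?sE ?flow_domE//= ?subrr.
Qed.

(** Every cylinder crossed uses up one unit of time, so only finitely many jumps occur before [t],
    even along a Zeno trajectory. *)
Lemma graph_exists_base n t x : 0 <= t -> t < n%:R ->
  exists y, susp_flow_graph t (base x) y.
Proof.
elim: n t x => [|n IH] t x t0 tn; first by lra.
have [ts|st] := leP t%:E (sigma x).
  by exists (base (phi t x)); exact: graph_flow.
have fx : sigma x \is a fin_num by exact: (impact_lt_fin Xcompact st).
have Gh := hit_guard Xcompact fx.
have s0 := fine_impact_ge0 H Xcompact x.
have st' : fine (sigma x) < t by rewrite -lte_fin fineK.
have xh : susp_flow_graph (fine (sigma x)) (base x) (cyl (hit H x) 0).
  by rewrite cyl0//; apply: graph_flow => //; rewrite fineK.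
have [t1|t1] := leP (t - fine (sigma x)) 1.
  exists (cyl (hit H x) (0 + (t - fine (sigma x)))).
  rewrite -{1}[t](subrK (fine (sigma x))); apply: Susp_flow_comp xh _.
  by apply: graph_cyl => //; rewrite ?add0r//; lra.
have [||y hy] := IH (t - fine (sigma x) - 1) (r (hit H x)); [lra| |].
  by move: tn; rewrite -natr1; lra.
exists y; rewrite -{1}[t](subrK (fine (sigma x))); apply: Susp_flow_comp xh _.
rewrite -[X in susp_flow_graph X](subrK 1); apply: Susp_flow_comp hy.
by rewrite -cyl1// -{2}[1]add0r; apply: graph_cyl => //; rewrite ?add0r.
Qed.

Lemma graph_exists (t : R) (y : suspension H) :
  0 <= t -> exists y', susp_flow_graph t y y'.
Proof.
move=> t0; case: (suspP y) => [[x ->]|[g [s [Gg /andP[s0 s1] ->]]]].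
  exact: (graph_exists_base x t0 (archi_boundP t0)).
have [st|st] := leP (s + t) 1.
  by exists (cyl g (s + t)); apply: graph_cyl => //; exact: ltW.
have t0' : 0 <= t - (1 - s) by lra.
have [y' hy'] := graph_exists_base (r g) t0' (archi_boundP t0').
exists y'; rewrite -[X in susp_flow_graph X](subrK (1 - s)).
apply: Susp_flow_comp hy'; rewrite -cyl1//.
rewrite (_ : cyl g 1 = cyl g (s + (1 - s))); last by congr cyl; lra.
by apply: graph_cyl => //; lra.
Qed.

Lemma susp_flowD (s t : R) (y : suspension H) : 0 <= s -> 0 <= t ->
  susp_flow H (s + t) y = susp_flow H s (susp_flow H t y).
Proof.
move=> s0 t0; have [y' yy'] := graph_exists y t0.
have [y'' yy''] := graph_exists y' s0.
rewrite (susp_flowE yy') (susp_flowE yy'').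
exact: (susp_flowE (Susp_flow_comp yy' yy'')).
Qed.

Lemma susp_flow_base (t : R) x : 0 <= t -> (t%:E <= sigma x)%E ->
  susp_flow H t (base x) = base (phi t x).
Proof. by move=> t0 ts; exact/susp_flowE/graph_flow. Qed.

Lemma susp_flow_cyl g s t : G g -> 0 <= s -> 0 <= t -> s + t <= 1 ->
  susp_flow H t (cyl g s) = cyl g (s + t).
Proof. by move=> *; exact/susp_flowE/graph_cyl. Qed.

End suspension_points.

(** * Topology of the suspension *)

Section suspension_topology.
Context {R : realType} {X : metricType R} (H : hybrid_system X).

Local Notation G := (guard H).
Local Notation r := (reset H).
Local Notation I01 := (`[0, 1]%classic : set R).
Local Notation base := (base H).
Local Notation cyl := (cyl H).

Lemma base_continuous : continuous base.
Proof.
move=> x; apply: (continuous_comp (g := susp_proj H)); last exact: pi_continuous.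
apply: (continuous_comp (f := @sum_base R X H)); last exact: pi_continuous.
exact: existT_continuous.
Qed.

Lemma near_fst (T1 T2 : topologicalType) (P : T1 -> Prop) (a : T1) (b : T2) :
  (\forall x \near a, P x) -> \forall p \near (a, b), P p.1.
Proof. by move=> Pa; exists (P, setT); [split=> //; exact: filterT|case=> ? ? []]. Qed.

Lemma near_snd (T1 T2 : topologicalType) (P : T2 -> Prop) (a : T1) (b : T2) :
  (\forall x \near b, P x) -> \forall p \near (a, b), P p.2.
Proof. by move=> Pa; exists (setT, P); [split=> //; exact: filterT|case=> ? ? []]. Qed.

Lemma nbhs_within (T : topologicalType) (A B : set T) (x : T) :
  nbhs x B -> within A (nbhs x) B.
Proof. by apply: filterS. Qed.

Local Notation GI := (G `*` I01).

Lemma cyl_continuous : {within GI, continuous (fun p : X * R => cyl p.1 p.2)}.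
Proof.
apply/subspace_sigL_continuousP => p.
have -> : sigL GI (fun p : X * R => cyl p.1 p.2) =
    susp_proj H \o (to_gluing _ \o existT (susp_piece H) false) \o
    @setX_of_sigT _ _ G I01.
  apply/funext => q.
  exact: (esym (susp_proj_cyl (setX_of_sigT G I01 q).1 (setX_of_sigT G I01 q).2)).
apply: continuous_comp; first exact: setX_of_sigT_continuous.
apply: continuous_comp; last exact: pi_continuous.
apply: continuous_comp; last exact: pi_continuous.
exact: existT_continuous.
Qed.

Lemma cyl_cvg (g : X) (s : R) : G g -> 0 <= s <= 1 ->
  cyl p.1 p.2 @[p --> within GI (nbhs (g, s))] --> cyl g s.
Proof.
move=> Gg s01; have /subspace_continuousP/(_ (g, s)) := cyl_continuous.
by apply; split=> //=; rewrite in_itv.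
Qed.

(** The hypotheses express openness of the preimage on the two summands; for the cylinders,
    neighbourhoods relative to [GI] in [X * R] replace subtypes. *)
Lemma susp_open (O : set (suspension H)) : open (base @^-1` O) ->
  (forall g s, G g -> 0 <= s <= 1 -> O (cyl g s) ->
    \forall p \near within GI (nbhs (g, s)), O (cyl p.1 p.2)) ->
  open O.
Proof.
move=> Ob Oc.
(* Openness in a quotient is openness of the preimage by definition, here for the two gluings in
   turn. *)
change (open (susp_proj H @^-1` O)).
change (open (to_gluing (glue_bottom (H := H)) @^-1` (susp_proj H @^-1` O))).
apply/sigT_openP => -[]; first exact: Ob.
rewrite openE => -[g s] /= Ogs; rewrite /interior /=.
have [Gg s01] := cyl'_val g s.
have Ogs' : O (cyl (\val g) (\val s)) by rewrite -susp_proj_cyl.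
have [[A B] /= [Ag Bs] AB] := Oc _ _ Gg s01 Ogs'.
exists (\val @^-1` A, \val @^-1` B) => /=.
  split; first exact: (@initial_continuous _ _ set_val g A Ag).
  exact: (@initial_continuous _ _ set_val s B Bs).
move=> [g' s'] [/= Ag' Bs']; have [Gg' s01'] := cyl'_val g' s'.
have : O (cyl (\val g') (\val s')).
  by apply: (AB (\val g', \val s')) => //; split=> //=; rewrite in_itv.
by rewrite -susp_proj_cyl.
Qed.

(** [V] is consulted only at heights strictly between 0 and 1; the compatibility conditions in the
    lemmas below make it correct at the ends too. *)
Definition susp_glue (U : set X) (V : set (X * R)) : set (suspension H) :=
  [set y | match susp_nf y with inl x => U x | inr p => V p end].

Lemma susp_glue_base (U : set X) (V : set (X * R)) (x : X) :
  susp_glue U V (base x) = U x.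
Proof. by rewrite /susp_glue /= susp_nf_base. Qed.

Lemma susp_glue_cyl (U : set X) (V : set (X * R)) (g : X) (s : R) :
  (forall g, G g -> V (g, 0) <-> U g) -> (forall g, G g -> V (g, 1) <-> U (r g)) ->
  G g -> 0 <= s <= 1 -> susp_glue U V (cyl g s) <-> V (g, s).
Proof.
move=> V0 V1 Gg /andP[s0 s1].
have [->|sN0] := eqVneq s 0; first by rewrite cyl0// susp_glue_base V0.
have [->|sN1] := eqVneq s 1; first by rewrite cyl1// susp_glue_base V1.
by rewrite /susp_glue /= susp_nf_cyl// !lt_neqAle s0 s1 sN1 eq_sym sN0.
Qed.

Lemma susp_glue_open (U : set X) (V : set (X * R)) : open U ->
  (forall g, G g -> V (g, 0) <-> U g) -> (forall g, G g -> V (g, 1) <-> U (r g)) ->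
  (forall g s, G g -> 0 <= s <= 1 -> V (g, s) -> within GI (nbhs (g, s)) V) ->
  open (susp_glue U V).
Proof.
move=> oU V0 V1 VV; apply: susp_open.
  by rewrite (_ : _ @^-1` _ = U)//; apply/funext => x; exact: susp_glue_base.
move=> g s Gg s01 /susp_glue_cyl => /(_ V0 V1 Gg s01) /VV => /(_ Gg s01).
rewrite /within/=; apply: filterS => -[g' s'] /= + [Gg' sI'].
move=> /(_ (conj Gg' sI')) Vgs; exact/susp_glue_cyl.
Qed.

Lemma near_reset (g : X) (s : R) (U : set X) : open U -> G g -> U (r g) ->
  within GI (nbhs (g, s)) [set p : X * R | U (r p.1)].
Proof.
move=> oU Gg Ug; have /subspace_continuousP/(_ g Gg) := @reset_continuous _ _ H.
move=> /(_ U (open_nbhs_nbhs (conj oU Ug))); rewrite /fmap/= => rU.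
have : \forall x \near g, G x -> U (r x) := rU.
by move=> /(@near_fst _ R _ _ s); apply: filterS => -[g' s'] /= + [Gg' _]; exact.
Qed.

(** Sets of the form [susp_glue] separate the three kinds of pairs: a base point and a point inside
    a cylinder, two base points, two points inside cylinders. *)
Lemma suspension_hausdorff : hausdorff_space (suspension H).
Proof.
have hX : hausdorff_space X by exact: metric_hausdorff.
rewrite open_hausdorff => y y'.
have bc x g s : G g -> 0 < s < 1 ->
  exists A B, [/\ A (base x), B (cyl g s), open A, open B & A `&` B = set0].
  move=> Gg /andP[s0 s1]; pose V := [set p : X * R | s / 2 < p.2 < (1 + s) / 2].
  pose V' := [set p : X * R | p.2 < s / 2 \/ (1 + s) / 2 < p.2].
  exists (susp_glue setT V'), (susp_glue set0 V).
  have e1 h : G h -> V (h, 0) <-> set0 h.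
    by move=> _; split=> //; rewrite /V/=; lra.
  have e2 h : G h -> V (h, 1) <-> set0 (r h).
    by move=> _; split=> //; rewrite /V/=; lra.
  have e3 h : G h -> V' (h, 0) <-> setT h.
    by move=> _; split=> // _; left=> /=; lra.
  have e4 h : G h -> V' (h, 1) <-> setT (r h).
    by move=> _; split=> // _; right=> /=; lra.
  split.
  - by rewrite susp_glue_base.
  - apply/susp_glue_cyl => //; rewrite /V /=; lra.
  - apply: susp_glue_open => // [|h t Gh t01 Vt]; first exact: openT.
    apply: nbhs_within.
    apply: (@near_snd X R (fun u => u < s / 2 \/ (1 + s) / 2 < u)).
    case: Vt => /= Vt.
      by near=> u; left; near: u; exact: lt_nbhsl.
    by near=> u; right; near: u; exact: lt_nbhsr.
  - apply: susp_glue_open => // [|h t Gh t01 /andP[Vt Vt']]; first exact: open0.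
    apply: nbhs_within.
    apply: (@near_snd X R (fun u => s / 2 < u < (1 + s) / 2)).
    by near=> u; apply/andP; split; near: u; [exact: lt_nbhsr|exact: lt_nbhsl].
  - apply/seteqP; split=> // z [] /=; rewrite /susp_glue/= /V/V'.
    by case: (susp_nf z) => // -[/= _ t]; lra.
have bb x x' : x <> x' ->
  exists A B, [/\ A (base x), B (base x'), open A, open B & A `&` B = set0].
  move=> /eqP xx'; move: hX; rewrite open_hausdorff => /(_ _ _ xx').
  case=> -[U U'] /= [/set_mem Ux /set_mem Ux'] [oU oU' /eqP UU'].
  (* An open set [W] of the base is thickened by the lower thirds of the cylinders over [W] and the
     upper thirds of those ending in [W]; the two thirds cannot meet, so disjoint sets stay
     disjoint. *)
  pose V (W : set X) (p : X * R) :=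
    p.2 < 1 / 3 /\ W p.1 \/ 2 / 3 < p.2 /\ W (r p.1).
  have oV W : open W -> open (susp_glue W (V W)).
    move=> oW; apply: susp_glue_open => // [g _|g _|g s Gg s01]; rewrite /V/=.
    - by split=> [[[]//|[]]|Wg]; [lra|left; split=> //; lra].
    - by split=> [[[]|[]//]|Wg]; [lra|right; split=> //; lra].
    - case=> -[s13 Wg].
        apply: nbhs_within; apply: filterS2
          (near_fst s (open_nbhs_nbhs (conj oW Wg))) (near_snd g (lt_nbhsl s13)).
        by move=> p Wp ps; left.
      have nr := near_reset s oW Gg Wg.
      have ns := nbhs_within GI (near_snd g (lt_nbhsr s13)).
      by apply: filterS2 nr ns => p Wp ps; right.
  exists (susp_glue U (V U)), (susp_glue U' (V U')).
  split; rewrite ?susp_glue_base//; [exact: oV|exact: oV|].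
  have dis z : U z -> U' z -> False.
    by move=> Uz Uz'; have : (U `&` U') z by []; rewrite UU'.
  apply/seteqP; split=> // z [] /=; rewrite /susp_glue/= /V.
  case: (susp_nf z) => [w|[g s]]/=; first exact: dis.
  by move=> [[s1 Ug]|[s1 Ug]] [[s2 Ug']|[s2 Ug']];
    exfalso; first [exact: (dis _ Ug Ug')|clear -s1 s2; lra].
have cc g s g' s' : G g -> 0 < s < 1 -> G g' -> 0 < s' < 1 -> (g, s) <> (g', s') ->
  exists A B, [/\ A (cyl g s), B (cyl g' s'), open A, open B & A `&` B = set0].
  move=> Gg s01 Gg' s01' gs.
  have [[W W'] [/= Wg Wg' oW oW' WW']] : exists W : set (X * R) * set (X * R),
      [/\ W.1 (g, s), W.2 (g', s'), open W.1, open W.2 & W.1 `&` W.2 = set0].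
    have [gg'|/eqP gg'] := pselect (g = g').
      have /eqP ss' : s <> s' by move=> ss'; apply: gs; rewrite gg' ss'.
      have := @Rhausdorff R; rewrite open_hausdorff => /(_ _ _ ss').
      case=> -[W W'] /= [/set_mem Ws /set_mem Ws'] [oW oW' /eqP WW'].
      exists (snd @^-1` W, snd @^-1` W'); split=> //=.
      - by apply: open_comp => // p _; exact: cvg_snd.
      - by apply: open_comp => // p _; exact: cvg_snd.
      - by rewrite -preimage_setI WW' preimage_set0.
    move: hX; rewrite open_hausdorff => /(_ _ _ gg').
    case=> -[W W'] /= [/set_mem Ws /set_mem Ws'] [oW oW' /eqP WW'].
    exists (fst @^-1` W, fst @^-1` W'); split=> //=.
    - by apply: open_comp => // p _; exact: cvg_fst.
    - by apply: open_comp => // p _; exact: cvg_fst.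
    - by rewrite -preimage_setI WW' preimage_set0.
  pose V (W : set (X * R)) : set (X * R) := [set p | 0 < p.2 < 1 /\ W p].
  have V0 Z h : G h -> V Z (h, 0) <-> set0 h.
    by move=> _; split=> [[/= ? _]|[]]; lra.
  have V1 Z h : G h -> V Z (h, 1) <-> set0 (r h).
    by move=> _; split=> [[/= ? _]|[]]; lra.
  have oV Z : open Z -> open (susp_glue set0 (V Z)).
    move=> oZ; apply: susp_glue_open; [exact: open0|exact: V0|exact: V1|].
    move=> h t Gh _ [/= /andP[t0 t1] Zht].
    apply: nbhs_within; apply: filterS3 (open_nbhs_nbhs (conj oZ Zht))
      (near_snd h (lt_nbhsl t1)) (near_snd h (lt_nbhsr t0)) => p Zp p1 p0.
    by split=> //; rewrite p0 p1.
  exists (susp_glue set0 (V W)), (susp_glue set0 (V W')).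
  have le01 u : 0 < u < 1 -> 0 <= u <= 1 by move=> /andP[u0 u1]; rewrite !ltW.
  split; [| |exact: oV..|].
    by apply/susp_glue_cyl; [exact: V0|exact: V1|by []|exact: le01|].
    by apply/susp_glue_cyl; [exact: V0|exact: V1|by []|exact: le01|].
  apply/seteqP; split=> // z [] /=; rewrite /susp_glue/= /V.
  case: (susp_nf z) => //= p [_ Wp] [_ Wp'].
  by have : (W `&` W') p by []; rewrite WW'.
case: (suspP y) => [[x ->]|[g [s [Gg s01 ->]]]];
  case: (suspP y') => [[x' ->]|[g' [s' [Gg' s01' ->]]]] /eqP yy'.
- have [|A [B [Ay By oA oB AB]]] := bb x x'.
    by move=> xx'; apply: yy'; rewrite xx'.
  by exists (A, B); rewrite !inE; split=> //; apply/eqP.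
- have [A [B [Ay By oA oB AB]]] := bc x g' s' Gg' s01'.
  by exists (A, B); rewrite !inE; split=> //; apply/eqP.
- have [A [B [Ay By oA oB AB]]] := bc x' g s Gg s01.
  by exists (B, A); rewrite !inE; split=> //=; rewrite setIC AB.
- have [|A [B [Ay By oA oB AB]]] := cc _ _ _ _ Gg s01 Gg' s01'.
    by move=> [gg ss]; apply: yy'; rewrite gg ss.
  by exists (A, B); rewrite !inE; split=> //; apply/eqP.
Unshelve. all: by end_near. Qed.
End suspension_topology.

(** * Hybrid trajectories and suspension orbits *)

Section orbits.
Context {R : realType} {X : metricType R} (H : hybrid_system X).
Context (Xcompact : compact [set: X]).

Local Notation phi := (flow H).
Local Notation G := (guard H).
Local Notation sigma := (impact_time H).
Local Notation r := (reset H).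
Local Notation base := (base H).
Local Notation cyl := (cyl H).
Local Notation Phi := (susp_flow H).

Lemma susp_flow0 y : Phi 0 y = y.
Proof.
case: (suspP y) => [[x ->]|[g [s [Gg /andP[s0 s1] ->]]]].
  by rewrite susp_flow_base ?flow0//; exact: impact_ge0.
by rewrite susp_flow_cyl ?addr0// ltW.
Qed.

Lemma susp_flow_hit x (s : R) : sigma x \is a fin_num -> 0 <= s <= 1 ->
  Phi (fine (sigma x) + s) (base x) = cyl (hit H x) s.
Proof.
move=> fx /andP[s0 s1]; have f0 := fine_impact_ge0 H Xcompact x.
have Gh := hit_guard Xcompact fx.
rewrite addrC susp_flowD// susp_flow_base ?fineK//.
by rewrite -/(hit H x) -cyl0// susp_flow_cyl ?add0r.
Qed.

Lemma susp_flow_jump x (t : R) : sigma x \is a fin_num -> 0 <= t ->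
  Phi (fine (sigma x) + 1 + t) (base x) = Phi t (base (r (hit H x))).
Proof.
move=> fx t0; have f0 := fine_impact_ge0 H Xcompact x.
rewrite addrC susp_flowD ?addr_ge0// susp_flow_hit ?lexx ?ler01//.
by rewrite cyl1//; exact: hit_guard.
Qed.

Lemma hybrid_reach_susp_flow x z : hybrid_reach H x z ->
  exists2 t, 0 <= t & Phi t (base x) = base z.
Proof.
elim=> {x z} [x t t0 ts|x z fx _ [t t0 tz]].
  by exists t => //; rewrite susp_flow_base.
have f0 := fine_impact_ge0 H Xcompact x.
exists (fine (sigma x) + 1 + t); first lra.
by rewrite susp_flow_jump.
Qed.

(** Induction on an integer bound for the time, as each cylinder takes one unit. The cylinders
    crossed stand over hit points, which are reached and so lie in [A]. *)
Lemma susp_flow_hybrid_reach x A : hybrid_reach H x `<=` A ->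
  forall t, 0 <= t -> susp_set H A (Phi t (base x)).
Proof.
move=> xA t t0; have := archi_boundP t0; move: (Num.bound t) => n.
elim: n x t xA t0 => [|n IH] x t xA t0 tn; first by exfalso; lra.
have [ts|st] := leP t%:E (sigma x).
  rewrite susp_setE susp_flow_base//; left; exists (phi t x) => //.
  by apply: xA; exact: Reach_flow.
have fx : sigma x \is a fin_num by exact: (impact_lt_fin Xcompact st).
have f0 := fine_impact_ge0 H Xcompact x.
have st' : fine (sigma x) < t by rewrite -lte_fin fineK.
have [t1|t1] := leP (t - fine (sigma x)) 1.
  rewrite (_ : t = fine (sigma x) + (t - fine (sigma x))); last lra.
  have s01 : 0 <= t - fine (sigma x) <= 1 by lra.
  rewrite susp_flow_hit// susp_setE; right.
  exists (hit H x), (t - fine (sigma x)); split=> //.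
    by apply: xA; exact: hybrid_reach_hit.
  exact: hit_guard.
rewrite (_ : t = fine (sigma x) + 1 + (t - fine (sigma x) - 1)); last lra.
rewrite susp_flow_jump//; last lra.
apply: IH; [|lra|by move: tn; rewrite -natr1; lra].
by move=> z rz; apply: xA; exact: Reach_jump.
Qed.

(** Backward steps of length at least 1 add up to any length, so a backward solution can be sought
    one step at a time. *)
Lemma semiflow_invm_steps (Q B : set (suspension H)) :
  (forall y, Q y -> exists y' a, [/\ Q y', 1 <= a, Phi a y' = y &
     forall s, 0 <= s <= a -> B (Phi s y')]) ->
  Q `<=` semiflow_invm Phi B.
Proof.
move=> step y Qy.
have /choice[f fP] : forall y, exists p : suspension H * R, Q y ->
    [/\ Q p.1, 1 <= p.2, Phi p.2 p.1 = y &
     forall s, 0 <= s <= p.2 -> B (Phi s p.1)].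
  move=> z; have [Qz|Qz] := pselect (Q z); last by exists (z, 0).
  by have [z' [a za]] := step z Qz; exists (z', a).
(* [z n] lies [n] steps before [y], and [A n] is the time from there to [y]. *)
pose z n := iter n (fun w => (f w).1) y.
pose A n : R := \sum_(i < n) (f (z i)).2.
have Qz n : Q (z n) by elim: n => // n /fP[].
have AS n : A n.+1 = A n + (f (z n)).2 by rewrite /A big_ord_recr.
have An n : n%:R <= A n.
  elim: n => [|n IH]; first by rewrite /A big_ord0.
  by have [_ ? _ _] := fP _ (Qz n); rewrite AS -natr1 lerD.
have zS n t : 0 <= A n + t -> Phi (A n.+1 + t) (z n.+1) = Phi (A n + t) (z n).
  move=> t0; have [_ a1 az _] := fP _ (Qz n).
  rewrite AS addrAC [LHS]susp_flowD//; last exact: le_trans ler01 a1.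
  by rewrite az.
have zm k n t : 0 <= A n + t ->
    Phi (A (k + n)%N + t) (z (k + n)%N) = Phi (A n + t) (z n).
  move=> t0; elim: k => // k IH; rewrite addSn zS// (le_trans t0)// lerD2r.
  elim: k {IH} => // k IH; have [_ ? _ _] := fP _ (Qz (k + n)%N).
  by rewrite addSn AS (le_trans IH)// lerDl (le_trans ler01).
have BA n s : 0 <= s <= A n -> B (Phi s (z n)).
  elim: n s => [|n IH] s sA.
    have [_ a1 az aB] := fP _ (Qz 0%N).
    have -> : s = 0 by move: sA; rewrite /A big_ord0; lra.
    by rewrite susp_flow0 -[z 0%N]az; apply: aB; rewrite lexx (le_trans _ a1)// ler01.
  have [_ a1 az aB] := fP _ (Qz n).
  have [sa|sa] := leP s (f (z n)).2.
    by apply: aB; rewrite sa; case/andP: sA => ->.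
  have a0 := le_trans ler01 a1.
  rewrite -[s](subrK (f (z n)).2) susp_flowD//; last by rewrite subr_ge0 ltW.
  by rewrite az; apply: IH; rewrite subr_ge0 ltW//= lerBlDr -AS; case/andP: sA.
have bnd t : t <= 0 -> 0 <= A (Num.bound (- t)) + t.
  move=> t0; have t0' : 0 <= - t by rewrite oppr_ge0.
  by rewrite -lerBlDr sub0r (le_trans (ltW (archi_boundP t0'))).
(* The value at [t] is computed from a point far enough in the past, as [n <= A n]; by [zm] any
   other such point gives the same value. *)
pose c t := Phi (A (Num.bound (- t)) + t) (z (Num.bound (- t))).
have cE t n : t <= 0 -> 0 <= A n + t -> c t = Phi (A n + t) (z n).
  move=> t0 n0; rewrite /c -(zm n _ _ (bnd _ t0)) addnC; exact: zm.
exists c; split.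
- by move=> t t0; apply: BA; rewrite bnd//= gerDl.
- by rewrite (cE 0 0%N)// /A big_ord0 addr0// susp_flow0.
- move=> s t s0 ts; have t0 : t <= 0 by lra.
  have n0 := bnd _ t0; rewrite /c -susp_flowD// -/(c (t + s)).
  by rewrite (cE _ (Num.bound (- t)))//; [congr Phi; lra|lra].
Qed.

Lemma susp_flow_guard g : G g -> Phi 1 (base g) = base (r g).
Proof. by move=> Gg; rewrite -cyl0// susp_flow_cyl// ?add0r// cyl1. Qed.

Context (Htrapping : trapping_guard H).

(* Near a guard point the impact time is small by continuity. *)
Lemma guard_no_escape g (d : R) : G g -> 0 < d ->
  exists2 s, 0 < s < d & G (phi s g).
Proof.
have [U [[oU GU] [fU cU] _ _ _]] := Htrapping => Gg d0.
have d20 : 0 < d / 2 by rewrite divr_gt0.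
have : sigma @ within U (nbhs g) --> sigma g.
  by move/subspace_continuousP: cU; apply; exact: GU.
rewrite (impact_time_guard Gg) => /(_ [set e | (e < (d / 2)%:E)%E]).
have nb : nbhs (0 : \bar R)%E [set e | (e < (d / 2)%:E)%E].
  by apply: open_nbhs_nbhs; split; [exact: open_ereal_lt_ereal|rewrite /= lte_fin].
move=> /(_ nb) sU.
have nU : \forall x \near g, U x /\ (sigma x < (d / 2)%:E)%E.
  have sU' : \forall x \near g, U x -> (sigma x < (d / 2)%:E)%E by exact: sU.
  apply: filterS2 (open_nbhs_nbhs (conj oU (GU _ Gg))) sU' => x Ux.
  by move=> /(_ Ux).
have [e /= e0 Pe] : \forall s \near (0 : R), 0 <= s ->
    U (phi s g) /\ (sigma (phi s g) < (d / 2)%:E)%E.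
  rewrite -{1}(flow0 H g) in nU.
  exact: (flow_cvg_time Xcompact (lexx 0) nU).
pose s := Num.min (e / 2) (d / 4).
have [s0 se sd] : [/\ 0 < s, s < e & s <= d / 4].
  rewrite /s lt_min gt_min ge_min lexx orbT !divr_gt0//.
  by rewrite ltr_pdivrMr// ltr_pMr// ltr1n.
have [|_ sl] := Pe s _ (ltW s0).
  by rewrite /= sub0r normrN gtr0_norm.
have fs : sigma (phi s g) \is a fin_num by exact: (impact_lt_fin Xcompact sl).
have f0 := fine_impact_ge0 H Xcompact (phi s g).
have fl : fine (sigma (phi s g)) < d / 2 by rewrite -lte_fin fineK.
exists (fine (sigma (phi s g)) + s); first lra.
by rewrite flowD//; [exact: (hit_guard Xcompact fs)|exact: ltW].
Qed.

(** * From backward hybrid trajectories to backward suspension orbits *)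

Section backward.
Context (x : X) (J : option nat) (t : nat -> R) (gam : nat -> R -> X).
Context (back : backward_trajectory H x J t gam).

Lemma back_itv_le k s : back_itv J t k s -> le_jumps k J /\ s <= t k.
Proof.
rewrite /back_itv; case: ifPn => [kJ /= /andP[_ ->]|_]; first by rewrite lt_jumpsW.
by case: ifP.
Qed.

Lemma back_itv_interior k (s s' w : R) : back_itv J t k s -> back_itv J t k s' ->
  s < w < s' -> (back_itv J t k)° w.
Proof.
move=> ks ks' /andP[sw ws'].
apply: (@filterS _ _ _ [set u | s < u < s']); last first.
  by near=> u; apply/andP; split; near: u; [exact: lt_nbhsr|exact: lt_nbhsl].
move=> u /andP[su us']; have [kJ st] := back_itv_le ks'.
move: ks; rewrite /back_itv; case: ifP => _ /=.
  move=> /andP[ts _]; rewrite (le_trans ts (ltW su)).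
  exact: le_trans (ltW us') st.
by rewrite kJ /= => _; exact: le_trans (ltW us') st.
Unshelve. all: by end_near. Qed.

(** An early hit could only occur at the starting point, since the interior of the arc avoids the
    guard; but then [guard_no_escape] gives another hit in the interior. *)
Lemma back_susp_flow k (s v : R) : 0 <= v ->
  back_itv J t k s -> back_itv J t k (s + v) ->
  Phi v (base (gam k s)) = base (gam k (s + v)).
Proof.
move=> v0 ks ksv; have [_ _ Gint _ seg] := back.
have gamE u : 0 <= u -> back_itv J t k (s + u) -> gam k (s + u) = phi u (gam k s).
  move=> u0 ksu; have [|_ ->] := seg _ _ _ ks ksu; first lra.
  by rewrite addrC addKr.
have noG u : 0 < u < v -> ~ G (phi u (gam k s)).
  move=> /andP[u0 uv]; have int : (back_itv J t k)° (s + u).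
    by apply: (back_itv_interior ks ksv); lra.
  by rewrite -gamE; [exact: Gint|exact: ltW|exact: interior_subset].
rewrite gamE//; apply: susp_flow_base => //.
rewrite leNgt; apply/negP => sv.
have fs : sigma (gam k s) \is a fin_num by exact: (impact_lt_fin Xcompact sv).
have Gh := hit_guard Xcompact fs.
have u0 := fine_impact_ge0 H Xcompact (gam k s).
have uv : fine (sigma (gam k s)) < v by rewrite -lte_fin fineK.
have [uE|uN0] := eqVneq (fine (sigma (gam k s))) 0; last first.
  by apply: (noG _ _ Gh); rewrite uv lt_neqAle eq_sym uN0 u0.
move: Gh; rewrite /hit uE flow0 => Gk.
have [w wv Gw] := guard_no_escape Gk (le_lt_trans u0 uv).
exact: noG wv Gw.
Qed.

Lemma back_itv_end k : le_jumps k J -> back_itv J t k (t k).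
Proof.
move=> kJ; have [[_ tS _] _ _ _ _] := back; rewrite /back_itv kJ.
by case: ifP => kJ' /=; rewrite lexx ?tS.
Qed.

Lemma back_trajectory_susp A : (forall k s, back_itv J t k s -> A (gam k s)) ->
  semiflow_invm Phi (susp_set H A) (base x).
Proof.
move=> gamA.
have baseA z : A z -> susp_set H A (base z).
  by move=> Az; rewrite susp_setE; left; exists z.
apply: (@semiflow_invm_steps
  [set y | exists k s, back_itv J t k s /\ y = base (gam k s)]); last first.
  have [[t0 _ <-] _ _ _ _] := back; exists 0%N, 0; split=> //.
  by rewrite -t0; apply: back_itv_end; case: J.
move=> _ [k [s [ks ->]]]; have [kJ sk] := back_itv_le ks.
have [lkJ|nlkJ] := boolP (lt_jumps k J); last first.
  (* The last arc extends to minus infinity: the step is one unit of flow. *)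
  have [ks1 ks0] : back_itv J t k (s - 1) /\
      forall v, v <= 1 -> back_itv J t k (s - 1 + v).
    rewrite /back_itv (negbTE nlkJ) kJ /=; split; first lra.
    by move=> v v1; rewrite (le_trans _ sk)//; lra.
  exists (base (gam k (s - 1))), 1; split=> //; first by exists k, (s - 1).
    by rewrite back_susp_flow ?subrK//; apply: ks0.
  move=> v /andP[v0 v1]; rewrite back_susp_flow//; last exact: ks0.
  by apply/baseA/gamA/ks0.
have [_ _ _ jump _] := back; have [Gg rg] := jump k lkJ.
have kJ' : le_jumps k.+1 J by case: J lkJ.
have [ks1 ks0] : t k.+1 <= s /\
    forall v, 0 <= v -> v <= s - t k.+1 -> back_itv J t k (t k.+1 + v).
  move: ks; rewrite /back_itv lkJ /= => /andP[ts _]; split=> // v v0 vs.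
  by apply/andP; split; lra.
have kt : back_itv J t k (t k.+1).
  by rewrite -[t k.+1]addr0; apply: ks0; rewrite ?subr_ge0.
have step v : 0 <= v -> v <= s - t k.+1 ->
    Phi (v + 1) (base (gam k.+1 (t k.+1))) = base (gam k (t k.+1 + v)).
  move=> v0 vs; rewrite susp_flowD// susp_flow_guard// rg back_susp_flow//.
  exact: ks0.
(* The step goes back to the start of the arc and down the cylinder before it, so its length is at
   least 1 however short the arc is. *)
exists (base (gam k.+1 (t k.+1))), (s - t k.+1 + 1); split.
- by exists k.+1, (t k.+1); split=> //; exact: back_itv_end.
- by rewrite lerDr subr_ge0.
- by rewrite step ?subr_ge0// addrC subrK.
- move=> v /andP[v0 vs]; have [v1|v1] := leP v 1.
    rewrite -cyl0// susp_flow_cyl ?add0r// susp_setE; right.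
    exists (gam k.+1 (t k.+1)), v; split=> //; last by rewrite v0.
    exact/gamA/back_itv_end.
  rewrite -[v](subrK 1) step; [|lra..].
  by apply/baseA/gamA/ks0; lra.
Qed.

End backward.

Lemma hybrid_invm_susp A x : hybrid_invm H A x ->
  semiflow_invm Phi (susp_set H A) (base x).
Proof. by move=> [J [t [gam [back gamA]]]]; exact: back_trajectory_susp gamA. Qed.

(** * From backward suspension orbits to backward hybrid trajectories *)

Section backward_solution.
Context (c : R -> suspension H).
Context (cflow : forall s t, 0 <= s -> t + s <= 0 -> Phi s (c t) = c (t + s)).

Let cE (a b : R) : a <= b -> b <= 0 -> c b = Phi (b - a) (c a).
Proof. by move=> ab b0; rewrite cflow ?subr_ge0 // addrC subrK. Qed.

(** At most one unit earlier the solution was in the base; from there it can get inside a cylinder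
    only through the bottom, and [cyl_inj] identifies the cylinder and the height. *)
Lemma solution_cyl_bottom g s t : t <= 0 -> G g -> 0 < s < 1 -> c t = cyl g s ->
  c (t - s) = base g.
Proof.
move=> t0 Gg s01 ct.
(* One unit earlier the solution is in the base, or at a height [s'] whose cylinder it leaves after
   [1 - s'], hence [b = s']. *)
have [b [w [b01 cb]]] : exists b w, 0 < b <= 1 /\ c (t - b) = base w.
  have [[w cw]|[g' [s' [Gg' s01' cg]]]] := suspP (c (t - 1)).
    by exists 1, w; split=> //; lra.
  exists s', (r g'); split; first lra.
  rewrite (@cE (t - 1)); [|lra..].
  by rewrite cg susp_flow_cyl//; [rewrite -cyl1//; congr cyl; lra|lra..].
have tb : c t = Phi b (base w) by rewrite -cb cflow ?subrK//; lra.
have [bs|sb] := leP b%:E (sigma w).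
  exfalso; move: tb; rewrite susp_flow_base//; last lra.
  by rewrite ct => /esym; exact: base_neq_cyl.
have fw : sigma w \is a fin_num by exact: (impact_lt_fin Xcompact sb).
have f0 := fine_impact_ge0 H Xcompact w.
have fb : fine (sigma w) < b by rewrite -lte_fin fineK.
have Gh := hit_guard Xcompact fw.
have bE : c t = cyl (hit H w) (b - fine (sigma w)).
  rewrite tb (_ : b = fine (sigma w) + (b - fine (sigma w))); last lra.
  by rewrite susp_flow_hit//; [congr cyl; lra|lra].
have [b1|b1] := eqVneq (b - fine (sigma w)) 1.
  by exfalso; move: bE; rewrite ct b1 cyl1// => /esym; exact: base_neq_cyl.
have bs1 : 0 < b - fine (sigma w) < 1.
  by rewrite subr_gt0 fb/= lt_neqAle b1/=; lra.
move: bE; rewrite ct => /(cyl_inj Gg s01 Gh bs1)[-> sE].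
rewrite (@cE (t - b)); [|lra..].
rewrite cb (_ : t - s - (t - b) = fine (sigma w)); last lra.
by rewrite susp_flow_base// fineK.
Qed.

Definition at_guard (t : R) : Prop := exists2 g, G g & c t = base g.

(* [jump_before t u]: the flow segment ending at time [t] starts at time [u + 1],
   after a cylinder entered at time [u]. *)
Definition jump_before (t u : R) : Prop := exists g,
  [/\ G g, c u = base g, u + 1 <= t & ((t - (u + 1))%:E <= sigma (r g))%E].

(** From the given guard visit the orbit is followed from cylinder to cylinder up to the last one
    before [t]; each takes one unit, so the induction on a bound for [t - u] ends. *)
Lemma jump_before_exists t z : t <= 0 -> c t = base z ->
  (exists2 u, u < t & at_guard u) -> exists u, jump_before t u.
Proof.
move=> t0 ct [u ut [g Gg cu]].
have tu0 : 0 <= t - u by rewrite subr_ge0 ltW.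
have := archi_boundP tu0; move: (Num.bound _) => n.
elim: n u g ut Gg cu tu0 => [|n IH] u g ut Gg cu tu0 tun; first by exfalso; lra.
(* Otherwise [c t] would be strictly inside the cylinder over [g]. *)
have ut1 : u + 1 <= t.
  rewrite leNgt; apply/negP => tu1.
  move: ct; rewrite (@cE u)//; last exact: ltW.
  rewrite cu -(cyl0 Gg) susp_flow_cyl// ?add0r//; [|lra].
  by move=> /esym; apply: base_neq_cyl => //; lra.
have cu1 : c (u + 1) = base (r g).
  by rewrite (@cE u); [|lra..]; rewrite addrC addKr cu susp_flow_guard.
have [ts|st] := leP (t - (u + 1))%:E (sigma (r g)); first by exists u, g.
have fw : sigma (r g) \is a fin_num by exact: (impact_lt_fin Xcompact st).
have f0 := fine_impact_ge0 H Xcompact (r g).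
have fb : fine (sigma (r g)) < t - (u + 1) by rewrite -lte_fin fineK.
apply: (IH (u + 1 + fine (sigma (r g))) (hit H (r g))).
- lra.
- exact: hit_guard.
- rewrite (@cE (u + 1)); [|lra..].
  by rewrite addrAC subrr add0r cu1 susp_flow_base// fineK.
- lra.
- by move: tun; rewrite -natr1; lra.
Qed.

(* Junk value [x] when [c t] lies inside the cylinder. *)
Definition foot (x : X) (t : R) : X := xget x [set w | c t = base w].

Lemma footE x t w : c t = base w -> foot x t = w.
Proof.
move=> ct; rewrite /foot; case: xgetP => [v _|/(_ w)//].
by rewrite /= ct => /base_inj.
Qed.

(** The jumps are read off backward with [jump_before], and the unit of time spent in each cylinder
    is cut out. *)
Lemma solution_hybrid_invm (B : set (suspension H)) x :
  (forall t, t <= 0 -> B (c t)) -> c 0 = base x ->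
  hybrid_invm H (base @^-1` B) x.
Proof.
move=> cB c0.
have [u [u0 uS]] : exists u : nat -> R, u 0%N = 0 /\
    forall k, (exists v, jump_before (u k) v) -> jump_before (u k) (u k.+1).
  have /choice[f fP] : forall v, exists w,
      (exists w', jump_before v w') -> jump_before v w.
    move=> v; have [[w vw]|nvw] := pselect (exists w', jump_before v w').
      by exists w.
    by exists v => /nvw.
  by exists (fun k => iter k f 0); split=> // k /fP.
pose last k := ~ exists2 v, v < u k & at_guard v.
(* [J] is the least index whose arc is preceded by no guard visit, infinite if there is none. *)
have [J [nlastJ lastJ]] : exists J, (forall k, lt_jumps k J -> ~ last k) /\
    forall m, J = Some m -> last m.
  have [[k lk]|nl] := pselect (exists k, `[< last k >]); last first.
    by exists None; split=> // k _ /asboolP lk; apply: nl; exists k.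
  have exl : exists k, `[< last k >] by exists k.
  exists (Some (ex_minn exl)); case: ex_minnP => m /asboolP lm mP.
  split=> [j /= jm /asboolP lj|_ [<-]//].
  by have := mP _ lj; rewrite leqNgt jm.
have uP k : le_jumps k J -> u k <= 0 /\ exists z, c (u k) = base z.
  elim: k => [_|k IH kJ]; first by rewrite u0; split=> //; exists x.
  have kJ' : lt_jumps k J by case: J kJ {nlastJ lastJ IH}.
  have [uk0 [z cz]] := IH (lt_jumpsW kJ').
  have /contrapT gk := nlastJ k kJ'.
  have [g [Gg cg uk1 _]] := uS _ (jump_before_exists uk0 cz gk).
  by split; [lra|exists g].
have uJ k : lt_jumps k J -> jump_before (u k) (u k.+1).
  move=> kJ; have [uk0 [z cz]] := uP k (lt_jumpsW kJ).
  have /contrapT gk := nlastJ k kJ.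
  exact: uS (jump_before_exists uk0 cz gk).
(* Between [u k] and 0 the solution crosses [k] cylinders, so on arc [k] hybrid time is suspension
   time plus [k]; the arc occupies suspension times from [u k.+1 + 1] to [u k]. *)
pose t k := u k + k%:R; pose gam k s := foot x (s - k%:R).
have tS k : t k.+1 = u k.+1 + 1 + k%:R by rewrite /t -natr1; lra.
have le0 k s : back_itv J t k s -> le_jumps k J /\ s - k%:R <= u k <= 0.
  move=> ks; have [kJ st] := back_itv_le ks; have [uk0 _] := uP k kJ.
  by split=> //; rewrite uk0 lerBlDr st.
(* Each point of an arc is in the base, with an impact time that covers the rest of the arc; the
   flow formula and the avoidance of the guard follow. *)
have seg0 k s s' : back_itv J t k s -> back_itv J t k s' -> s <= s' ->
    c (s - k%:R) = base (gam k s) /\ ((s' - s)%:E <= sigma (gam k s))%E.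
  move=> ks ks' ss'; have [kJ /andP[sk uk0]] := le0 _ _ ks.
  have [_ /andP[sk' _]] := le0 _ _ ks'.
  suff [v cv vs] : exists2 v, c (s - k%:R) = base v & ((s' - s)%:E <= sigma v)%E.
    by rewrite /gam (footE _ cv).
  have [lkJ|nlkJ] := boolP (lt_jumps k J).
    have [g [Gg cg uk1 uks]] := uJ k lkJ.
    have [ts st'] : t k.+1 <= s /\ s' <= t k.
      by move: ks ks'; rewrite /back_itv lkJ /= => /andP[ts _] /andP[_].
    have ps : ((s - t k.+1)%:E <= sigma (r g))%E.
      by apply: le_trans uks; rewrite lee_fin tS; lra.
    have cg1 : c (u k.+1 + 1) = base (r g).
      rewrite (@cE (u k.+1)) ?lerDl//; last exact: le_trans uk0.
      by rewrite addrAC subrr add0r cg susp_flow_guard.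
    exists (phi (s - t k.+1) (r g)).
      rewrite (@cE (u k.+1 + 1)); [|rewrite tS in ts; lra|exact: le_trans uk0].
      rewrite cg1 (_ : _ - _ = s - t k.+1); last by rewrite tS; lra.
      by rewrite susp_flow_base// subr_ge0.
    rewrite impact_flow ?subr_ge0// leeBrDr// -EFinD.
    by apply: le_trans uks; rewrite lee_fin tS /t in st' *; lra.
  have lk : last k by exact/lastJ/le_jumps_last.
  (* A point of the last arc inside a cylinder would come from its bottom, which is an earlier guard
     visit. *)
  have [v cv] : exists v, c (s - k%:R) = base v.
    have [[v cv]|[g [w [Gg w01 cg]]]] := suspP (c (s - k%:R)); first by exists v.
    exfalso; apply: lk; exists (s - k%:R - w); first lra.
    exists g => //; apply: solution_cyl_bottom => //.
    exact: le_trans uk0.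
  exists v => //; rewrite leNgt; apply/negP => sv.
  have fs : sigma v \is a fin_num by exact: (impact_lt_fin Xcompact sv).
  have f0 := fine_impact_ge0 H Xcompact v.
  have fb : fine (sigma v) < s' - s by rewrite -lte_fin fineK.
  apply: lk; exists (s - k%:R + fine (sigma v)); first lra.
  exists (hit H v); first exact: hit_guard.
  rewrite (@cE (s - k%:R)); [|lra..].
  by rewrite addrAC subrr add0r cv susp_flow_base// fineK.
have seg k s s' : back_itv J t k s -> back_itv J t k s' -> s <= s' ->
    gam k s' = phi (s' - s) (gam k s).
  move=> ks ks' ss'; have [cs vs] := seg0 _ _ _ ks ks' ss'.
  have [_ /andP[sk' uk0]] := le0 _ _ ks'.
  apply: footE; rewrite (@cE (s - k%:R)) ?lerB//; last exact: le_trans uk0.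
  rewrite cs (_ : _ - _ = s' - s); last lra.
  by rewrite susp_flow_base ?subr_ge0.
exists J, t, gam; split; last first.
  move=> k s ks; have [/= <- _] := seg0 _ _ _ ks ks (lexx s).
  by apply: cB; have [_ /andP[]] := le0 _ _ ks; exact: le_trans.
split.
- split.
  + by rewrite /t u0 addr0.
  + move=> k kJ; have [g [_ _ uk _]] := uJ k kJ.
    by rewrite tS lerD2r.
  + by rewrite /gam subr0; exact: footE.
- move=> k; apply/subspace_continuousP => s ks.
  (* All points of the arc near [s] lie after [b], so continuity is that of the flow started at
     [gam k b]. *)
  have [b [kb bs nb]] : exists b, [/\ back_itv J t k b, b <= s &
      \forall w \near s, back_itv J t k w -> b <= w].
    have [kJ st] := back_itv_le ks.
    move: ks; rewrite /back_itv kJ; case: ifP => _ /= => [/andP[ts _]|_].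
      exists (t k.+1); split=> //; last by near=> w => /andP[].
      by rewrite lexx (le_trans ts).
    exists (s - 1); split; [lra|lra|].
    near=> w => _; near: w; apply: filterS (lt_nbhsr _) => [w|]; first exact: ltW.
    by rewrite ltrBlDr ltrDl.
  have wb : within (back_itv J t k) (nbhs s) --> within [set w | b <= w] (nbhs s).
    by apply: cvg_within_near; [exact: cvg_within|exact: nb].
  have : gam k w @[w --> within (back_itv J t k) (nbhs s)] --> gam k s; last by [].
  rewrite (seg _ _ _ kb ks bs).
  apply: cvg_trans (cvg_trans (cvg_app _ wb)
    (flow_cvg_shift Xcompact (x := gam k b) bs)).
  apply: near_eq_cvg; rewrite near_withinE; apply: filterS nb => w bw kw.
  by rewrite -seg// bw.
- move=> k s sI Gks; have [e /= e0 se] := sI.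
  have ks := interior_subset sI.
  have e20 : 0 < e / 2 by rewrite divr_gt0.
  have ks' : back_itv J t k (s + e / 2).
    by apply: se => /=; rewrite opprD addNKr normrN gtr0_norm//; lra.
  have [|_] := seg0 _ _ _ ks ks'; first lra.
  by rewrite (impact_time_guard Gks) lee_fin; lra.
- move=> k kJ; have [g [Gg cg uk _]] := uJ k kJ.
  have -> : gam k.+1 (t k.+1) = g.
    by apply: footE; rewrite /t addrK.
  split=> //; apply/esym/footE; rewrite tS addrK.
  have [uk0 _] := uP k (lt_jumpsW kJ).
  rewrite (@cE (u k.+1)) ?lerDl//; last exact: le_trans uk0.
  by rewrite addrC addKr cg susp_flow_guard.
- move=> k s s' ks ks' ss'; rewrite flow_domE//=; split.
    by rewrite subr_ge0.
  exact: seg.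
Unshelve. all: by end_near. Qed.

End backward_solution.

End orbits.

(** * Isolating neighbourhoods *)

Section isolation.
Context {R : realType} {X : metricType R} (H : hybrid_system X).
Context (Xcompact : compact [set: X]).
Context (Hnonblocking : nonblocking H) (Htrapping : trapping_guard H).

Local Notation G := (guard H).
Local Notation sigma := (impact_time H).
Local Notation r := (reset H).
Local Notation I01 := (`[0, 1]%classic : set R).
Local Notation base := (base H).
Local Notation cyl := (cyl H).
Local Notation susp_glue := (@susp_glue R X H).
Local Notation Phi := (susp_flow H).
Local Notation Inv := (Inv_for (hybrid_invp H) (hybrid_invm H)).
Local Notation SInv := (Inv_for (semiflow_invp Phi) (semiflow_invm Phi)).

Lemma hybrid_invpE A x : hybrid_invp H A x = (hybrid_reach H x `<=` A).
Proof. by rewrite /hybrid_invp /= traj_rangeE. Qed.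

Lemma hybrid_Inv_subset A B : A `<=` B -> Inv A `<=` Inv B.
Proof.
move=> AB x [xp [J [t [gam [back gamA]]]]]; split; first exact: subset_trans xp AB.
by exists J, t, gam; split=> // k s /gamA/AB.
Qed.

Lemma semiflow_Inv_subset (A B : set (suspension H)) : A `<=` B -> SInv A `<=` SInv B.
Proof.
move=> AB y [yp [c [cA c0 cS]]]; split; first by move=> t /yp/AB.
by exists c; split=> // t /cA/AB.
Qed.

Lemma Inv_base A x : Inv A x -> SInv (susp_set H A) (base x).
Proof.
move=> [xp xm]; split; last exact: hybrid_invm_susp.
by move: xp; rewrite hybrid_invpE => xp t; exact: susp_flow_hybrid_reach.
Qed.

Lemma base_Inv (B : set (suspension H)) x : SInv B (base x) -> Inv (base @^-1` B) x.
Proof.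
move=> [xp [c [cB c0 cS]]]; split; last exact: solution_hybrid_invm cS _ _ cB c0.
rewrite hybrid_invpE => z /(hybrid_reach_susp_flow Xcompact)[t t0 tz] /=.
by rewrite -tz; exact: xp.
Qed.

(** The past of [Phi s y] is the past of [y] followed by the orbit of [y]; the first backward step
    goes as far as [c (- 1)] to have length at least 1. *)
Lemma SInv_flow (B : set (suspension H)) y s : SInv B y -> 0 <= s -> SInv B (Phi s y).
Proof.
move=> [yp [c [cB c0 cS]]] s0; split.
  by move=> t t0; rewrite -susp_flowD//; apply: yp; exact: addr_ge0.
apply: (@semiflow_invm_steps _ _ _ Xcompact
  [set z | z = Phi s y \/ exists2 t, t <= 0 & z = c t]); last by left.
move=> z [->|[t t0 ->]].
  exists (c (- 1)), (s + 1); split; first by right; exists (- 1) => //; lra.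
  - by rewrite lerDr.
  - by rewrite susp_flowD// cS ?addNr// c0.
  - move=> u /andP[u0 us]; have [u1|u1] := leP u 1.
      by rewrite cS//; [apply: cB|]; lra.
    rewrite -[u](subrK 1) susp_flowD//; [|lra..].
    by rewrite cS ?addNr// c0; apply: yp; lra.
exists (c (t - 1)), 1; split=> //; first by right; exists (t - 1) => //; lra.
  by rewrite cS ?subrK//.
by move=> u /andP[u0 u1]; rewrite cS//; [apply: cB|]; lra.
Qed.

(** A backward solution through [cyl g s] passes [base g] at time [- s]; what precedes is the past
    of [base g], and what follows is the start of its forward orbit. *)
Lemma SInv_cyl (B : set (suspension H)) g s :
  G g -> 0 < s < 1 -> SInv B (cyl g s) -> SInv B (base g).
Proof.
move=> Gg s01 [yp [c [cB c0 cS]]].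
have cg : c (0 - s) = base g by exact: (solution_cyl_bottom Xcompact cS).
rewrite sub0r in cg; have [s0 s1] := andP s01.
split=> [t t0|]; last first.
  exists (fun t => c (t - s)); split.
  - by move=> t t0; apply: cB; lra.
  - by rewrite sub0r.
  - by move=> u t u0 tu; rewrite cS//; [congr c; lra|lra].
have [ts|st] := leP t s.
  by rewrite -cg cS//; [apply: cB|]; lra.
rewrite -[t](subrK s) susp_flowD//; [|lra..].
rewrite -cyl0// susp_flow_cyl// ?add0r//; [|lra..].
by apply: yp; lra.
Qed.

(** The top of the cylinder over [g] is [base (r g)], which belongs to the suspension of [A] as soon
    as [g] is in [A]; the hypothesis accounts for these points. *)
Lemma base_susp_set A x : (forall g, A g -> G g -> A (r g)) ->
  susp_set H A (base x) -> A x.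
Proof.
move=> Ar; rewrite susp_setE => -[[x' Ax' /base_inj<-//]|[g [s [Ag Gg s01]]]].
have [->|s0] := eqVneq s 0; first by rewrite cyl0// => /base_inj->.
have [->|s1] := eqVneq s 1; first by rewrite cyl1// => /base_inj->; exact: Ar.
by move=> /base_neq_cyl []//; rewrite !lt_neqAle s1 eq_sym s0.
Qed.

Section invariant.
Context (S : set X) (Sinv : hybrid_invariant H S).

Lemma invariant_reach x z : S x -> hybrid_reach H x z -> S z.
Proof. by have [SE _] := Sinv; rewrite {1}SE hybrid_invpE => Sx; exact: Sx. Qed.

Lemma invariant_hit x : S x -> sigma x \is a fin_num -> S (hit H x).
Proof. by move=> Sx fx; apply: (invariant_reach Sx); exact: hybrid_reach_hit. Qed.

Lemma invariant_reset g : S g -> G g -> S (r g).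
Proof.
move=> Sg Gg; apply: (invariant_reach Sg).
have sg := impact_time_guard Gg; have fg : sigma g \is a fin_num by rewrite sg.
apply: Reach_jump => //; rewrite (_ : hit H g = g); first exact: hybrid_reach_refl.
by rewrite /hit sg flow0.
Qed.

Lemma invariant_Inv : S `<=` Inv S.
Proof. by have [S1 S2] := Sinv; move=> x Sx; split; [rewrite -S1|rewrite -S2]. Qed.

Lemma invariant_SInv : susp_set H S `<=` SInv (susp_set H S).
Proof.
move=> y; rewrite {1}susp_setE => -[[x Sx <-]|[g [s [Sg Gg /andP[s0 s1] ->]]]].
  exact/Inv_base/invariant_Inv.
rewrite (_ : cyl g s = Phi s (base g)).
  by apply: SInv_flow => //; exact/Inv_base/invariant_Inv.
by rewrite -cyl0// susp_flow_cyl ?add0r.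
Qed.

Lemma isolated_susp : hybrid_isolated_invariant H S ->
  semiflow_isolated_invariant Phi (susp_set H S).
Proof.
move=> [K [Kc Kint] SK].
have SK0 : S `<=` K° by rewrite SK.
have SsubK : S `<=` K by move=> x /SK0/interior_subset.
have Kcl : closed K by apply: compact_closed => //; exact: metric_hausdorff.
pose I1 := `[0, 1 / 2]%classic : set R; pose I2 := `[1 / 2, 1]%classic : set R.
pose rK := r @^-1` K `&` G.
have rKc : compact rK.
  apply: (subclosed_compact _ Xcompact) => //.
  rewrite /rK closed_setIS; last exact: guard_closed.
  by move/continuous_closedP : (@reset_continuous _ _ H); apply.
have GKc : compact (K `&` G).
  apply: (subclosed_compact _ Kc); last by move=> x [].
  by apply: closedI => //; exact: guard_closed.
pose cyl2 (p : X * R) := cyl p.1 p.2.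
have cylc (A : set X) (B : set R) : compact A -> compact B -> A `<=` G ->
    B `<=` I01 -> compact (cyl2 @` (A `*` B)).
  move=> Ac Bc AG BI; apply: continuous_compact; last exact: compact_setX.
  apply: continuous_subspaceW (cyl_continuous (H := H)).
  by move=> p [/AG ? /BI ?]; split.
pose K' := base @` K `|` cyl2 @` ((K `&` G) `*` I1) `|` cyl2 @` (rK `*` I2).
(* The cylinder halves add no base point outside [K]: a bottom has [g] in [K], a top has [r g] in
   [K]. *)
have K'base x : K' (base x) -> K x.
  case=> [[[z Kz /base_inj<-//]|]|] [[g s]] /= [[Kg Gg]].
    rewrite /I1 /= in_itv/= => /andP[s0 s1]; rewrite /cyl2/=.
    have [->|sN0] := eqVneq s 0; first by rewrite cyl0// => /base_inj<-.
    by move=> /esym/base_neq_cyl[]//; rewrite lt_neqAle eq_sym sN0 s0/=; lra.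
  rewrite /I2 /= in_itv/= => /andP[s0 s1]; rewrite /cyl2/=.
  have [->|sN1] := eqVneq s 1; first by rewrite cyl1// => /base_inj<-.
  by move=> /esym/base_neq_cyl[]//; rewrite (lt_neqAle s) sN1 s1 andbT; lra.
(* The cylinder part of an open set inside [K']. At height 1/2 both conditions are imposed, which
   makes it open, whereas [K'] asks for either one. *)
pose V : set (X * R) :=
  [set p | (p.2 <= 1 / 2 -> K° p.1) /\ (1 / 2 <= p.2 -> K° (r p.1))].
have V0 g : G g -> V (g, 0) <-> K° g.
  move=> _; split=> [[/= + _]|Kg]; first by apply; lra.
  by split=> //=; rewrite leNgt divr_gt0.
have V1 g : G g -> V (g, 1) <-> K° (r g).
  move=> _; split=> [[/= _]|Kg]; first by apply; lra.
  by split=> //=; rewrite ler_pdivlMr// mul1r -[2]/(1 + 1) gerDl ler10.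
have oO : open (susp_glue K° V).
  apply: susp_glue_open => //; first exact: open_interior.
  move=> g s Gg s01 [/= Vl Vr].
  have nl : s <= 1 / 2 -> within (G `*` I01) (nbhs (g, s)) [set p | K° p.1].
    move=> s12; apply: nbhs_within; apply: (near_fst s).
    by apply: open_nbhs_nbhs; split; [exact: open_interior|exact: Vl].
  have nr : 1 / 2 <= s -> within (G `*` I01) (nbhs (g, s)) [set p | K° (r p.1)].
    by move=> s12; apply: near_reset => //; [exact: open_interior|exact: Vr].
  have [s12|s12|s12] := ltgtP s (1 / 2).
  - have ns := nbhs_within (G `*` I01) (near_snd g (lt_nbhsl s12)).
    apply: filterS2 (nl (ltW s12)) ns => p Kp ps; split=> //=.
    by rewrite leNgt ps.
  - have ns := nbhs_within (G `*` I01) (near_snd g (lt_nbhsr s12)).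
    apply: filterS2 (nr (ltW s12)) ns => p Kp ps; split=> //=.
    by rewrite leNgt ps.
  - have [le1 le2] : s <= 1 / 2 /\ 1 / 2 <= s by rewrite s12.
    by apply: filterS2 (nl le1) (nr le2) => p Kp Krp; split.
have SO : susp_set H S `<=` susp_glue K° V.
  move=> y; rewrite susp_setE => -[[x /SK0 Kx <-]|[g [s [Sg Gg s01 ->]]]].
    by rewrite susp_glue_base.
  apply/susp_glue_cyl => //; split=> _ /=; first exact: SK0.
  exact/SK0/invariant_reset.
have OK' : susp_glue K° V `<=` K'.
  move=> y; have [[x ->]|[g [s [Gg s01 ->]]]] := suspP y.
    by rewrite susp_glue_base => /interior_subset Kx; left; left; exists x.
  rewrite /susp_glue/= susp_nf_cyl// => -[/= Vl Vr].
  have [s12|s12] := leP s (1 / 2).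
    left; right; exists (g, s) => //; split.
      by split=> //; exact: interior_subset (Vl s12).
    by rewrite /I1/= in_itv/=; lra.
  right; exists (g, s) => //; split.
    by split=> //; exact: interior_subset (Vr (ltW s12)).
  by rewrite /I2/= in_itv/=; lra.
have SE : susp_set H S = SInv K'.
  apply/seteqP; split.
    apply: subset_trans invariant_SInv _; apply: semiflow_Inv_subset.
    exact: subset_trans SO OK'.
  have InvS x : SInv K' (base x) -> S x.
    by move=> /base_Inv xK; rewrite SK; apply: hybrid_Inv_subset xK => z /K'base.
  move=> y yK; rewrite susp_setE.
  have [[x yE]|[g [s [Gg s01 yE]]]] := suspP y; rewrite yE in yK *.
    by left; exists x => //; exact: InvS.
  right; exists g, s; split=> //; first exact: InvS (SInv_cyl Gg s01 yK).
  by case/andP: s01 => s0 s1; rewrite !ltW.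
exists K' => //; split.
  apply: compactU; first apply: compactU.
  - apply: continuous_compact Kc; apply: continuous_subspaceT.
    exact: base_continuous.
  - apply: cylc GKc (@segment_compact _ _ _) _ _; first by move=> x [].
    by move=> s; rewrite /I1/= !in_itv/=; lra.
  - apply: cylc rKc (@segment_compact _ _ _) _ _; first by move=> x [].
    by move=> s; rewrite /I2/= !in_itv/=; lra.
rewrite -SE => y /SO Oy; apply: filterS OK' _.
exact: open_nbhs_nbhs.
Qed.

Lemma susp_isolated : semiflow_isolated_invariant Phi (susp_set H S) ->
  hybrid_isolated_invariant H S.
Proof.
move=> [K' [K'c K'int] SK'].
have K'cl : closed K' by apply: compact_closed => //; exact: suspension_hausdorff.
have SK0 : susp_set H S `<=` K'° by rewrite SK'.
have [U [[oU GU] [fU _] Hc _ _]] := Htrapping.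
have hitG g : G g -> hit H g = g.
  by move=> Gg; rewrite /hit (impact_time_guard Gg) flow0.
(* [hit] is the trapping homotopy at parameter 1, hence continuous on [U]. *)
have hitc x : U x -> hit H z @[z --> x] --> hit H x.
  move=> Ux W nW; have UI : (U `*` I01) (x, 1).
    by split=> //=; rewrite in_itv/= ler01 lexx.
  have trapE z : trapping_homotopy H z 1 = hit H z by rewrite /trapping_homotopy mul1r.
  have : trapping_homotopy H p.1 p.2 @[p --> within (U `*` I01) (nbhs (x, 1 : R))] -->
      trapping_homotopy H x 1.
    by move/subspace_continuousP : Hc => /(_ _ UI).
  rewrite trapE => /(_ W nW)[[A B] /= [Ax B1] AB].
  apply: filterS2 Ax (open_nbhs_nbhs (conj oU Ux)) => z Az Uz.
  have := AB (z, 1); rewrite /= trapE; apply.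
    by split=> //; exact: nbhs_singleton.
  by split=> //=; rewrite in_itv/= ler01 lexx.
have cylU (O : set (suspension H)) x s : open O -> U x ->
    I01 s -> O (cyl (hit H x) s) ->
    \forall x' \near x & s' \near s, I01 s' -> O (cyl (hit H x') s').
  move=> oO Ux Is Os; have Gh := hit_guard Xcompact (fU _ Ux).
  have s01 : 0 <= s <= 1 by move: Is; rewrite /= in_itv.
  have [[A B] /= [Ah Bs] AB] := cyl_cvg Gh s01 (open_nbhs_nbhs (conj oO Os)).
  exists ([set x' | A (hit H x') /\ U x'], B).
    by split=> //=; apply: filterI; [exact: hitc|exact: open_nbhs_nbhs].
  move=> [x' s'] /= [[Ax' Ux'] Bs'] Is'; apply: (AB (hit H x', s')) => //.
  by split=> //=; exact: (hit_guard Xcompact (fU _ Ux')).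
(* The margin between [W] and [U] keeps [hit] continuous on [closure W], so that the extra condition
   in [K] can be controlled at the boundary of [W]. *)
have [W [oW GW WU]] : exists W : set X, [/\ open W, G `<=` W & closure W `<=` U].
  have nX : normal_space X by apply: compact_normal => //; exact: metric_hausdorff.
  have [|F /set_nbhsP[W [oW GW WF]] FU] := nX G (@guard_closed _ _ H) U.
    by apply/set_nbhsP; exists U; split.
  by exists W; split=> //; apply: subset_trans FU; exact: closureS.
pose K := [set x | K' (base x) /\ (W x -> forall s, I01 s -> K' (cyl (hit H x) s))].
have Kcl : closed K.
  rewrite -openC openE => x nKx; rewrite /interior.
  have [K'x|nK'x] := pselect (K' (base x)); last first.
    have nb : nbhs (base x) (~` K').
      by apply: open_nbhs_nbhs; split=> //; exact: closed_openC.
    have nx : nbhs x (base @^-1` (~` K')) := @base_continuous _ _ H x _ nb.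
    by apply: filterS nx => z nK'z [].
  (* The extra condition fails at some height [s], and by continuity it fails at this height for all
     nearby points. *)
  have [Wx [s Is nK's]] : W x /\ exists2 s, I01 s & ~ K' (cyl (hit H x) s).
    apply: contrapT => nW; apply: nKx; split=> // Wx s Is.
    by apply: contrapT => nK's; apply: nW; split=> //; exists s.
  have Ux : U x by apply/WU/subset_closure.
  have [[A B] /= [Ax Bs] AB] := cylU _ _ _ (closed_openC K'cl) Ux Is nK's.
  apply: filterS2 Ax (open_nbhs_nbhs (conj oW Wx)) => z Az Wz [_ /(_ Wz s Is)].
  by apply: (AB (z, s)) => //; split=> //; exact: nbhs_singleton.
have SK : S `<=` K°.
  move=> x Sx.
  have K'x : K'° (base x) by apply: SK0; rewrite susp_setE; left; exists x.
  have nx : nbhs x (base @^-1` K') := @base_continuous _ _ H x _ K'x.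
  have [clx|nclx] := pselect (closure W x); last first.
    have nW : nbhs x (~` closure W).
      by apply: open_nbhs_nbhs; split=> //; exact/closed_openC/closed_closure.
    apply: filterS2 nx nW => z K'z nWz; split=> // Wz.
    by exfalso; apply/nWz/subset_closure.
  have Ux := WU _ clx.
  have Gh := hit_guard Xcompact (fU _ Ux).
  have hs s : I01 s -> K'° (cyl (hit H x) s).
    rewrite /= in_itv/= => s01; apply: SK0; rewrite susp_setE; right.
    by exists (hit H x), s; split=> //; exact: invariant_hit (fU _ Ux).
  (* Compactness of the unit interval gives one neighbourhood of [x] that serves all heights. *)
  have tube : \forall z \near x, I01 `<=` (fun s => I01 s -> K'° (cyl (hit H z) s)).
    have /compact_near_coveringP := @segment_compact R 0 1.
    apply=> s Is; have := cylU _ _ _ (@open_interior _ K') Ux Is (hs s Is).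
    case=> -[A B] /= [Ax Bs] AB; exists (B, A) => //= -[s' z] /= [Bs' Az].
    exact: (AB (z, s')).
  apply: filterS2 nx tube => z K'z Kz; split=> // _ s Is.
  exact: interior_subset (Kz s Is Is).
have SsubK : S `<=` K by move=> x /SK/interior_subset.
(* A guard point lies in [W] and is its own hit, so the extra condition puts the whole cylinder over
   it in [K']. *)
have KK' : susp_set H K `<=` K'.
  move=> y; rewrite susp_setE => -[[x [K'x _] <-//]|[g [s [[_ Kg] Gg s01 ->]]]].
  by rewrite -(hitG _ Gg); apply: Kg; [exact: GW|rewrite /= in_itv].
have SE : S = Inv K.
  apply/seteqP; split; first by move=> x /invariant_Inv; exact: hybrid_Inv_subset.
  move=> x /Inv_base/(semiflow_Inv_subset KK'); rewrite -SK'.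
  by apply: base_susp_set => g; exact: invariant_reset.
exists K => //; split; last by rewrite -SE.
exact: (subclosed_compact Kcl Xcompact).
Qed.

End invariant.
End isolation.

Theorem theorem3p13 (R : realType) (X : metricType R)
    (Xcompact : compact [set: X]%classic)
    (H : hybrid_system X) (Hnonblocking : nonblocking H)
    (Htrapping : trapping_guard H)
    (S : set X) (Sinvariant : hybrid_invariant H S) :
  hybrid_isolated_invariant H S <->
  semiflow_isolated_invariant (susp_flow H) (susp_set H S).
Proof. by split; [exact: isolated_susp|exact: susp_isolated]. Qed.
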